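(* Let $A=(A_1,\ldots,A_N)$ be an $N$-tuple of complex $n\times m$ matrices with $\bigcap_{\ell}\ker A_\ell=\{0\}$ and $\bigcap_\ell\ker A_\ell^\dagger=\{0\}$. Then $$\inf_{g,h}\left\| \left( \sum_{\ell=1}^N gA_\ell h^{\dagger}h A_\ell^{\dagger}g^{\dagger} - \frac{1}{n} I,\ \sum_{\ell=1}^N hA_\ell^{\dagger}g^{\dagger}g A_\ell h^{\dagger} -\frac{1}{m}I \right) \right\| = \sup_{a,b, \sigma, \tau} \Bigl(- \max \{ a_i + b_j \mid \exists \ell:\ (\sigma A_\ell \tau^{\dagger})_{ij} \neq 0\}\Bigr),$$ where the infimum on the left is taken over all $g \in GL_n(\mathbb{C})$, $h \in GL_m(\mathbb{C})$ with $\|gAh^{\dagger}\| = 1$, and the supremum on the right is taken over all $\sigma \in SU_n$, $\tau \in SU_m$, $a \in \mathbb{R}^n$, $b \in \mathbb{R}^m$ with $\|(a,b)\| \leq 1$ and $\mathbf{1}^{\top} a = \mathbf{1}^{\top} b = 0$.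
   Context: $n,m,N$ are positive integers and $\dagger$ denotes conjugate transpose. $gAh^\dagger:=(gA_1h^\dagger,\ldots,gA_Nh^\dagger)$, and for a matrix tuple $B$, $\|B\|:=(\sum_\ell\mathrm{tr}\,B_\ell B_\ell^\dagger)^{1/2}$. For a pair of matrices, $\|(X,Y)\|:=(\|X\|_{\rm F}^2+\|Y\|_{\rm F}^2)^{1/2}$ (Frobenius norms); $\|(a,b)\|$ is the Euclidean norm. $\mathbf{1}$ is the all-ones vector. *)

(* Defs.v *)
From mathcomp Require Export all_boot all_order all_algebra.
From mathcomp Require Export complex.
From mathcomp Require Export boolp classical_sets reals constructive_ereal ereal.

Set Implicit Arguments.
Unset Strict Implicit.
Unset Printing Implicit Defensive.

Import Order.TTheory GRing.Theory Num.Theory.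
Import ComplexField.

Local Open Scope ring_scope.
Local Open Scope complex_scope.
Local Open Scope sesquilinear_scope.

(* The complex numbers are [R[i]] for [R : realType]; [M ^t*] is the conjugate
   transpose of [M]. *)

Definition tuple_act (R : realType) (n m N : nat)
    (g : 'M[R[i]]_n) (A : 'I_N -> 'M[R[i]]_(n, m)) (h : 'M[R[i]]_m) :
    'I_N -> 'M[R[i]]_(n, m) :=
  fun l => g *m A l *m h ^t*.

(* [Re] only transports the sum of traces, which is a nonnegative real, from
   [R[i]] to [R]. *)
Definition tuple_norm (R : realType) (n m N : nat)
    (B : 'I_N -> 'M[R[i]]_(n, m)) : R :=
  Num.sqrt (complex.Re (\sum_l \tr (B l *m (B l) ^t*))).

Definition frobenius_norm (R : realType) (p q : nat) (X : 'M[R[i]]_(p, q)) : R :=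
  Num.sqrt (\sum_i \sum_j Normc.normc (X i j) ^+ 2).

Definition mxpair_norm (R : realType) (p q r s : nat)
    (X : 'M[R[i]]_(p, q)) (Y : 'M[R[i]]_(r, s)) : R :=
  Num.sqrt (frobenius_norm X ^+ 2 + frobenius_norm Y ^+ 2).

(* The norm that the library puts on real vectors is the sup norm, hence this
   definition of the Euclidean norm of [(a, b)]. *)
Definition vecpair_norm (R : realType) (n m : nat)
    (a : 'cV[R]_n) (b : 'cV[R]_m) : R :=
  Num.sqrt (\sum_i a i 0 ^+ 2 + \sum_j b j 0 ^+ 2).

Definition special_unitary (R : realType) (n : nat) (U : 'M[R[i]]_n) : Prop :=
  U \is unitarymx /\ \det U = 1.

(* The maximum of [a_i + b_j] over the joint support of [B], valued in the
   extended reals: it is a real number unless all [B l] vanish, in which case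
   it is [-oo]. *)
Definition max_weight (R : realType) (n m N : nat)
    (B : 'I_N -> 'M[R[i]]_(n, m)) (a : 'cV[R]_n) (b : 'cV[R]_m) : \bar R :=
  \big[maxe/-oo%E]_(ij : 'I_n * 'I_m | [exists l, B l ij.1 ij.2 != 0])
    (a ij.1 0 + b ij.2 0)%:E.

(* Main.v *)
(* The left-hand side is the least norm of the gradient of the convex function
   log |g A h^*|^2 on the symmetric space of pairs (g^* g, h^* h), and the
   right-hand side is the best rate of decay of this function along geodesic rays.

   sup <= inf: writing g sigma^* = U T with U unitary and T preserving the flag of
   sublevel sets of a (and likewise for h), one gets g A h^* = U B V^* where the
   weights a_i + b_j on the support of B are at most those on the support of
   sigma A tau^*.  Then <(a, b), moment of B> = sum (a_i + b_j) |B_ij|^2 is at most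
   this maximum, and Cauchy-Schwarz concludes.

   inf <= sup: let kappa be the infimum.  For rho > 0 minimise
   Phi = sum_ij |(sigma A tau^* )_ij|^2 e^(rho (a_i + b_j)) over the compact set of
   unitary sigma, tau and of traceless (a, b) in the unit ball.  At a minimiser the
   moment is diagonal (variation of sigma, tau) and is a nonpositive multiple of
   (a, b) (variation of a, b), so that its pairing with (a, b) is minus its norm,
   hence at most - kappa.  By convexity
   sum_ij |(sigma A tau^* )_ij|^2 e^(s (a_i + b_j + kappa)) <= |A|^2
   for 0 <= s <= rho.  A cluster point of the minimisers as rho tends to infinity
   satisfies this for all s >= 0, so a_i + b_j <= - kappa on its support. *)

Require Import Defs.
From mathcomp Require Import perm normedtype derive sequences exp ring lra.

Set Implicit Arguments.
Unset Strict Implicit.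
Unset Printing Implicit Defensive.

Import Order.TTheory GRing.Theory Num.Theory.
Import numFieldNormedType.Exports.
Local Open Scope classical_set_scope.
Local Open Scope ring_scope.
Local Open Scope complex_scope.
Local Open Scope sesquilinear_scope.

(** * Tuples, masses and moments *)

Definition sqnormc (R : rcfType) (z : R[i]) : R :=
  complex.Re z ^+ 2 + complex.Im z ^+ 2.

Lemma sqnormcE (R : rcfType) (z : R[i]) : Normc.normc z ^+ 2 = sqnormc z.
Proof. by case: z => x y /=; rewrite sqr_sqrtr // addr_ge0 ?sqr_ge0. Qed.

Lemma sqnormc_ge0 (R : rcfType) (z : R[i]) : 0 <= sqnormc z.
Proof. by rewrite addr_ge0 ?sqr_ge0. Qed.

Lemma sqnormc_gt0 (R : rcfType) (z : R[i]) : z != 0 -> 0 < sqnormc z.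
Proof.
move=> z0; rewrite lt_def sqnormc_ge0 andbT; apply: contra z0.
rewrite /sqnormc paddr_eq0 ?sqr_ge0 // !sqrf_eq0 => /andP[/eqP x0 /eqP y0].
by rewrite eq_complex x0 y0 !eqxx.
Qed.

Lemma sqnormc0 (R : rcfType) : sqnormc (0 : R[i]) = 0.
Proof. by rewrite /sqnormc /= expr0n /= addr0. Qed.

Lemma conjCE (R : rcfType) (z : R[i]) : Num.conj z = conjc z.
Proof. by []. Qed.

Lemma sqnormcC (R : rcfType) (z : R[i]) : (sqnormc z)%:C = z * Num.conj z.
Proof. by rewrite conjCE -sqr_normc -add_Re2_Im2. Qed.

Lemma Re_sum (R : rcfType) (I : Type) (r : seq I) (P : pred I) (F : I -> R[i]) :
  complex.Re (\sum_(i <- r | P i) F i) = \sum_(i <- r | P i) complex.Re (F i).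
Proof. by apply: (big_morph (@complex.Re R)) => // -[? ?] [? ?]. Qed.

Lemma ReB (R : rcfType) (x y : R[i]) :
  complex.Re (x - y) = complex.Re x - complex.Re y.
Proof. by case: x y => [? ?] [? ?]. Qed.

Lemma Re_sqr_le (R : rcfType) (z : R[i]) : complex.Re z ^+ 2 <= sqnormc z.
Proof. by rewrite lerDl sqr_ge0. Qed.

(** The squared length of the vector of all (i, j) entries. It vanishes exactly off the joint
    support over which [max_weight] ranges. *)
Definition mass (R : realType) (n m N : nat) (B : 'I_N -> 'M[R[i]]_(n, m))
  (i : 'I_n) (j : 'I_m) : R := \sum_l sqnormc (B l i j).

Lemma mass_ge0 (R : realType) (n m N : nat) (B : 'I_N -> 'M[R[i]]_(n, m)) i j :
  0 <= mass B i j.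
Proof. by apply: sumr_ge0 => l _; exact: sqnormc_ge0. Qed.

Lemma adjmxE (R : rcfType) (p q : nat) (M : 'M[R[i]]_(p, q)) i j :
  (M ^t*) i j = Num.conj (M j i).
Proof. by rewrite !mxE. Qed.

Lemma adjmxK (R : rcfType) (p q : nat) (M : 'M[R[i]]_(p, q)) : M ^t* ^t* = M.
Proof. by apply/matrixP => i j; rewrite !adjmxE conjCK. Qed.

Lemma adjmxM (R : rcfType) (p q r : nat) (M : 'M[R[i]]_(p, q)) (P : 'M[R[i]]_(q, r)) :
  (M *m P) ^t* = P ^t* *m M ^t*.
Proof. by rewrite trmx_mul map_mxM. Qed.

Definition moment (R : realType) (n m N : nat) (B : 'I_N -> 'M[R[i]]_(n, m)) :
  'M[R[i]]_n := \sum_l B l *m (B l) ^t*.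

(** The second component of the moment map is the moment of the adjoint tuple, so that every result
    on rows yields one on columns by passing to adjoints. *)
Definition adj_tuple (R : realType) (n m N : nat) (B : 'I_N -> 'M[R[i]]_(n, m)) :
  'I_N -> 'M[R[i]]_(m, n) := fun l => (B l) ^t*.

Definition moment_norm (R : realType) (n m N : nat)
    (B : 'I_N -> 'M[R[i]]_(n, m)) : R :=
  mxpair_norm (moment B - (n%:R^-1)%:M) (moment (adj_tuple B) - (m%:R^-1)%:M).

Lemma mass_adj (R : realType) (n m N : nat) (B : 'I_N -> 'M[R[i]]_(n, m)) i j :
  mass (adj_tuple B) j i = mass B i j.
Proof.
apply: eq_bigr => l _; rewrite /adj_tuple adjmxE conjCE.
by case: (B l i j) => x y; rewrite /sqnormc /= sqrrN.
Qed.

Lemma diag_moment (R : realType) (n m N : nat) (B : 'I_N -> 'M[R[i]]_(n, m)) i :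
  moment B i i = (\sum_j mass B i j)%:C.
Proof.
rewrite /moment /mass exchange_big summxE rmorph_sum /=; apply: eq_bigr => l _.
rewrite mxE rmorph_sum /=; apply: eq_bigr => j _.
by rewrite adjmxE sqnormcC.
Qed.

Lemma tuple_norm_trace (R : realType) (n m N : nat) (B : 'I_N -> 'M[R[i]]_(n, m)) :
  tuple_norm B = Num.sqrt (complex.Re (\tr (moment B))).
Proof. by rewrite /tuple_norm /moment [\tr _]raddf_sum. Qed.

Lemma tuple_normE (R : realType) (n m N : nat) (B : 'I_N -> 'M[R[i]]_(n, m)) :
  tuple_norm B = Num.sqrt (\sum_i \sum_j mass B i j).
Proof.
rewrite tuple_norm_trace /mxtrace (eq_bigr _ (fun i _ => diag_moment B i)).
by rewrite -rmorph_sum.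
Qed.

Lemma frobenius_normE (R : realType) (p q : nat) (X : 'M[R[i]]_(p, q)) :
  frobenius_norm X ^+ 2 = complex.Re (\tr (X *m X ^t*)).
Proof.
rewrite /frobenius_norm sqr_sqrtr; last first.
  by apply: sumr_ge0 => i _; apply: sumr_ge0 => j _; rewrite sqr_ge0.
rewrite /mxtrace Re_sum; apply: eq_bigr => i _; rewrite mxE Re_sum.
by apply: eq_bigr => j _; rewrite adjmxE -sqnormcC sqnormcE.
Qed.

Lemma frobenius_norm_sum (R : realType) (p q : nat) (X : 'M[R[i]]_(p, q)) :
  frobenius_norm X ^+ 2 = \sum_i \sum_j sqnormc (X i j).
Proof.
rewrite /frobenius_norm sqr_sqrtr; last first.
  by apply: sumr_ge0 => i _; apply: sumr_ge0 => j _; rewrite sqr_ge0.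
by apply: eq_bigr => i _; apply: eq_bigr => j _; rewrite sqnormcE.
Qed.

(** * Invariance under unitary matrices *)

Lemma unitarymxPV (R : rcfType) (p : nat) (U : 'M[R[i]]_p) :
  U \is unitarymx -> U ^t* *m U = 1%:M.
Proof. by move=> /unitarymxP /mulmx1C. Qed.

Lemma unitary_adj (R : rcfType) (p : nat) (U : 'M[R[i]]_p) :
  U \is unitarymx -> U ^t* \is unitarymx.
Proof. by move=> hU; apply/unitarymxP; rewrite adjmxK unitarymxPV. Qed.

Lemma unitaryM (R : rcfType) (p : nat) (U V : 'M[R[i]]_p) :
  U \is unitarymx -> V \is unitarymx -> U *m V \is unitarymx.
Proof.
move=> hU hV; apply/unitarymxP; rewrite adjmxM mulmxA -(mulmxA U).
by rewrite (unitarymxP hV) mulmx1 (unitarymxP hU).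
Qed.

Lemma frobenius_unitary (R : realType) (p : nat) (U X : 'M[R[i]]_p) :
  U \is unitarymx -> frobenius_norm (U *m X *m U ^t*) ^+ 2 = frobenius_norm X ^+ 2.
Proof.
move=> hU; rewrite !frobenius_normE !adjmxM adjmxK !mulmxA.
rewrite -(mulmxA (U *m X)) (unitarymxPV hU) mulmx1 mxtrace_mulC !mulmxA.
by rewrite unitarymxPV // mul1mx.
Qed.

Lemma moment_unitary (R : realType) (n m N : nat) (U : 'M[R[i]]_n)
    (B : 'I_N -> 'M[R[i]]_(n, m)) (V : 'M[R[i]]_m) :
  V \is unitarymx ->
  moment (tuple_act U B V) = U *m moment B *m U ^t*.
Proof.
move=> hV; rewrite /moment mulmx_sumr mulmx_suml; apply: eq_bigr => l _.
rewrite /tuple_act (adjmxM (U *m B l)) (adjmxM U) adjmxK !mulmxA.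
by rewrite -(mulmxA (U *m B l)) (unitarymxPV hV) mulmx1.
Qed.

Lemma adj_tuple_act (R : realType) (n m N : nat) (U : 'M[R[i]]_n)
    (B : 'I_N -> 'M[R[i]]_(n, m)) (V : 'M[R[i]]_m) :
  adj_tuple (tuple_act U B V) = tuple_act V (adj_tuple B) U.
Proof.
by apply/funext => l; rewrite /adj_tuple /tuple_act !adjmxM adjmxK mulmxA.
Qed.

Lemma tuple_actM (R : realType) (n m N : nat) (g g' : 'M[R[i]]_n)
    (B : 'I_N -> 'M[R[i]]_(n, m)) (h h' : 'M[R[i]]_m) :
  tuple_act g (tuple_act g' B h') h = tuple_act (g *m g') B (h *m h').
Proof. by apply/funext => l; rewrite /tuple_act adjmxM !mulmxA. Qed.

Lemma conj_scalar_unitary (R : realType) (p : nat) (U X : 'M[R[i]]_p) c :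
  U \is unitarymx -> U *m X *m U ^t* - c%:M = U *m (X - c%:M) *m U ^t*.
Proof.
move=> hU; rewrite mulmxBr mulmxBl; congr (_ - _).
by rewrite mul_mx_scalar -scalemxAl (unitarymxP _) // scalemx1.
Qed.

Lemma moment_norm_unitary (R : realType) (n m N : nat) (U : 'M[R[i]]_n)
    (B : 'I_N -> 'M[R[i]]_(n, m)) (V : 'M[R[i]]_m) :
  U \is unitarymx -> V \is unitarymx ->
  moment_norm (tuple_act U B V) = moment_norm B.
Proof.
move=> hU hV; rewrite /moment_norm adj_tuple_act !moment_unitary //.
by rewrite !conj_scalar_unitary // /mxpair_norm !frobenius_unitary.
Qed.

Lemma tuple_norm_unitary (R : realType) (n m N : nat) (U : 'M[R[i]]_n)
    (B : 'I_N -> 'M[R[i]]_(n, m)) (V : 'M[R[i]]_m) :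
  U \is unitarymx -> V \is unitarymx ->
  tuple_norm (tuple_act U B V) = tuple_norm B.
Proof.
move=> hU hV; rewrite !tuple_norm_trace moment_unitary //.
by rewrite mxtrace_mulC mulmxA unitarymxPV // mul1mx.
Qed.

Lemma moment_normE (R : realType) (n m N : nat) (A : 'I_N -> 'M[R[i]]_(n, m)) g h :
  mxpair_norm
    (\sum_(l < N) g *m A l *m h ^t* *m h *m (A l) ^t* *m g ^t* - (n%:R^-1)%:M)
    (\sum_(l < N) h *m (A l) ^t* *m g ^t* *m g *m A l *m h ^t* - (m%:R^-1)%:M)
  = moment_norm (tuple_act g A h).
Proof.
have <- : moment (tuple_act g A h) =
    \sum_(l < N) g *m A l *m h ^t* *m h *m (A l) ^t* *m g ^t*.
  apply: eq_bigr => l _.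
  by rewrite /tuple_act (adjmxM (g *m A l)) (adjmxM g) adjmxK !mulmxA.
have <- // : moment (adj_tuple (tuple_act g A h)) =
    \sum_(l < N) h *m (A l) ^t* *m g ^t* *m g *m A l *m h ^t*.
rewrite adj_tuple_act; apply: eq_bigr => l _.
rewrite /tuple_act (adjmxM (h *m _)) (adjmxM h).
by rewrite /adj_tuple !adjmxK !mulmxA.
Qed.

(** Expanding sum (K u + x)^2 >= 0 and bounding both squares by K^2 leaves 0 <= 2 K (K + sum u x).
    The case K = 0, where one cannot divide, forces x = 0. *)
Lemma cauchy_schwarz_ball (R : realFieldType) (I : finType) (u x : I -> R) (K : R) :
  0 <= K -> \sum_k u k ^+ 2 <= 1 -> \sum_k x k ^+ 2 <= K ^+ 2 ->
  - K <= \sum_k u k * x k.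
Proof.
rewrite le_eqVlt => /orP[/eqP <- hu hx|K0 hu hx].
  rewrite oppr0 big1 // => k _; suff -> : x k = 0 by rewrite mulr0.
  have h0 : \sum_k x k ^+ 2 = 0.
    apply/eqP; rewrite eq_le sumr_ge0 ?andbT => [|? _]; last exact: sqr_ge0.
    by move: hx; rewrite expr0n.
  have := psumr_eq0P (fun k _ => sqr_ge0 (x k)) h0 => /(_ k isT).
  by move=> /eqP; rewrite sqrf_eq0 => /eqP.
have : 0 <= \sum_k (K * u k + x k) ^+ 2 by apply: sumr_ge0 => k _; exact: sqr_ge0.
have -> : \sum_k (K * u k + x k) ^+ 2 =
    K ^+ 2 * \sum_k u k ^+ 2 + 2 * K * \sum_k u k * x k + \sum_k x k ^+ 2.
  by rewrite !mulr_sumr -!big_split /=; apply: eq_bigr => k _; ring.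
move=> h.
have h1 : K ^+ 2 * \sum_i u i ^+ 2 <= K ^+ 2 by rewrite ler_piMr // sqr_ge0.
have : 0 <= 2 * K * (K + \sum_i u i * x i) by nra.
by rewrite pmulr_rge0 ?mulr_gt0 // => h2; lra.
Qed.

(** * Weak duality *)

Lemma sorting_perm (R : realDomainType) (p : nat) (a : 'I_p -> R) :
  exists s : 'S_p, forall i k : 'I_p, (i <= k)%N -> a (s i) <= a (s k).
Proof.
pose leT := [rel i j : 'I_p | a i <= a j].
have tot : total leT by move=> i j; exact: le_total.
have tr : transitive leT by move=> i j k; exact: le_trans.
pose t := sort leT (enum 'I_p).
have st : size t = p by rewrite size_sort size_enum_ord.
have ut : uniq t by rewrite sort_uniq enum_uniq.
(* A nonempty index type supplies the default element of [nth]. *)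
case: p => [|p] in a leT tot tr t st ut *; first by exists 1%g => -[].
have inj : injective (fun i : 'I_p.+1 => nth ord0 t i).
  by move=> i j /eqP; rewrite nth_uniq ?st ?ltn_ord // => /eqP /val_inj.
exists (perm inj) => i k ik; rewrite !permE.
have := sort_sorted tot (enum 'I_p.+1); rewrite -/t => so.
have := sorted_leq_nth tr (fun x => lexx (a x)) ord0 so.
by apply=> //; rewrite inE st ltn_ord.
Qed.

(* QR decomposition along the flag of sublevel sets of [a]. *)
Lemma flag_qr (R : realType) (p : nat) (g : 'M[R[i]]_p) (a : 'I_p -> R) :
  exists (U T : 'M[R[i]]_p),
    [/\ U \is unitarymx, g = U *m T & forall i k, T i k != 0 -> a i <= a k].
Proof.
have [s hs] := sorting_perm a.
(* Gram-Schmidt on the rows of g^*, listed by increasing [a], keeps the spans of initial segments;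
   hence the coefficient matrix [L] is lower triangular. *)
pose B := schmidt (row_perm s (g ^t*)).
have hB : B \is unitarymx by exact: schmidt_unitarymx.
pose L := row_perm s (g ^t*) *m B ^t*.
have hL i k : L i k != 0 -> (k <= i)%N.
  apply: contraTT; rewrite -ltnNge negbK => ik; apply/eqP.
  have /sub_sumsmxP[c hc] := row_schmidt_sub (row_perm s (g ^t*)) i.
  have -> : L i k = (row i L) 0 k by rewrite [RHS]mxE.
  rewrite row_mul hc mulmx_suml summxE big1 // => j ji.
  have /submxP[d hd] : (c j *m <<row j B>> <= row j B)%MS.
    by apply: submx_trans (submxMl _ _) _; rewrite genmxE.
  rewrite -/B hd -mulmxA -row_mul (unitarymxP hB) mxE big1 // => z _.
  rewrite ord1 !mxE; case: eqP => [jk|_]; last by rewrite mulr0.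
  by move: ji; rewrite jk leqNgt ik.
have gL : row_perm s (g ^t*) = L *m B.
  by rewrite /L -mulmxA unitarymxPV // mulmx1.
clearbody L; pose P : 'M[R[i]]_p := perm_mx s.
have PE : P ^t* = perm_mx s^-1.
  apply/matrixP => i j; rewrite adjmxE !mxE rmorph_nat.
  by rewrite (can2_eq (permKV s) (permK s)) eq_sym.
have hP : P \is unitarymx.
  by apply/unitarymxP; rewrite PE -perm_mxM mulgV perm_mx1.
(* Conjugation by the permutation matrix brings the triangular factor back to the original indices.
   Taking adjoints then puts the unitary factor on the left. *)
have gE : g ^t* = (P ^t* *m L *m P) *m (P ^t* *m B).
  rewrite -!mulmxA (mulmxA P) (unitarymxP hP) mul1mx -gL.
  by rewrite row_permE mulmxA unitarymxPV // mul1mx.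
exists ((P ^t* *m B) ^t*), ((P ^t* *m L *m P) ^t*); split.
- exact: unitary_adj (unitaryM (unitary_adj hP) hB).
- by rewrite -(adjmxM (P ^t* *m L *m P)) -gE adjmxK.
- move=> i k; rewrite adjmxE fmorph_eq0 PE -row_permE => h.
  suff /hL /hs : L (s^-1 k)%g (s^-1 i)%g != 0 by rewrite !permKV.
  move: h; rewrite mxE (bigD1 (s^-1 i)%g) //=.
  rewrite big1 => [|j ji]; last first.
    rewrite [X in _ * X]mxE [X in _ * X]mxE.
    have -> : s j == i = false.
      by apply: contraNF ji => /eqP <-; rewrite permK.
    by rewrite mulr0.
  by rewrite mxE [X in _ * X]mxE [X in _ * X]mxE permKV eqxx mulr1 addr0.
Qed.

Lemma big_sum_split (R : nmodType) (I J : finType) (F : I + J -> R) :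
  \sum_k F k = \sum_i F (inl i) + \sum_j F (inr j).
Proof. by rewrite big_sumType. Qed.

Lemma trace_moment_weight (R : realType) (n m N : nat)
    (B : 'I_N -> 'M[R[i]]_(n, m)) (a : 'I_n -> R) (b : 'I_m -> R) :
  \sum_i a i * (\sum_j mass B i j) + \sum_j b j * (\sum_i mass B i j) =
  \sum_i \sum_j (a i + b j) * mass B i j.
Proof.
under [X in X + _]eq_bigr do rewrite mulr_sumr.
under [X in _ + X]eq_bigr do rewrite mulr_sumr.
rewrite [X in _ + X]exchange_big -big_split; apply: eq_bigr => i _ /=.
by rewrite -big_split; apply: eq_bigr => j _; rewrite mulrDl.
Qed.

Lemma mass_eq0 (R : realType) (n m N : nat) (B : 'I_N -> 'M[R[i]]_(n, m)) i j :
  (forall l, B l i j = 0) -> mass B i j = 0.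
Proof. by move=> h; apply: big1 => l _; rewrite h sqnormc0. Qed.

Lemma Re_diag_moment_shift (R : realType) (n m N : nat)
    (B : 'I_N -> 'M[R[i]]_(n, m)) (c : R) i :
  complex.Re ((moment B - (c%:C)%:M) i i) = \sum_j mass B i j - c.
Proof.
have -> : (moment B - (c%:C)%:M) i i = (\sum_j mass B i j)%:C - c%:C.
  by rewrite -diag_moment mxE [X in _ + X]mxE [X in _ - X]mxE eqxx.
by rewrite -rmorphB.
Qed.

Lemma invn_complex (R : realType) (p : nat) : (p%:R^-1 : R[i]) = (p%:R^-1 : R)%:C.
Proof. by rewrite fmorphV rmorph_nat. Qed.

Lemma moment_normE_sum (R : realType) (n m N : nat) (B : 'I_N -> 'M[R[i]]_(n, m)) :
  moment_norm B ^+ 2 =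
    \sum_i \sum_k sqnormc ((moment B - (n%:R^-1)%:M) i k) +
    \sum_j \sum_k sqnormc ((moment (adj_tuple B) - (m%:R^-1)%:M) j k).
Proof.
by rewrite /moment_norm /mxpair_norm sqr_sqrtr ?addr_ge0 ?sqr_ge0 // !frobenius_norm_sum.
Qed.

Lemma moment_norm_ge0 (R : realType) (n m N : nat) (B : 'I_N -> 'M[R[i]]_(n, m)) :
  0 <= moment_norm B.
Proof. exact: sqrtr_ge0. Qed.

Lemma sqr_diag_le (R : realType) (p : nat) (X : 'M[R[i]]_p) :
  \sum_i complex.Re (X i i) ^+ 2 <= \sum_i \sum_k sqnormc (X i k).
Proof.
apply: ler_sum => i _; apply: le_trans (Re_sqr_le _) _.
by rewrite (bigD1 i) //= lerDl sumr_ge0 // => k _; exact: sqnormc_ge0.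
Qed.

Lemma vecpair_norm_le1 (R : realType) (n m : nat) (a : 'cV[R]_n) (b : 'cV[R]_m) :
  (vecpair_norm a b <= 1) = (\sum_i a i 0 ^+ 2 + \sum_j b j 0 ^+ 2 <= 1).
Proof.
rewrite /vecpair_norm -[in LHS](sqrtr1 R) ler_psqrt // qualifE /= ?ler01 //.
by rewrite addr_ge0 // sumr_ge0 // => i _; exact: sqr_ge0.
Qed.

Lemma tuple_norm1 (R : realType) (n m N : nat) (B : 'I_N -> 'M[R[i]]_(n, m)) :
  tuple_norm B = 1 -> \sum_i \sum_j mass B i j = 1.
Proof.
rewrite tuple_normE => h; rewrite -[LHS]sqr_sqrtr ?h ?expr1n //.
by do 2!apply: sumr_ge0 => ? _; exact: mass_ge0.
Qed.

(** As [a] and [b] sum to zero, the shifts 1/n and 1/m drop out of the pairing of (a, b) with the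
    diagonals of the moments. What remains is an average of a_i + b_j for the masses, whose total is
    1, so it is at most [mu]. *)
Lemma weight_bound (R : realType) (n m N : nat) (B : 'I_N -> 'M[R[i]]_(n, m))
    (a : 'I_n -> R) (b : 'I_m -> R) (mu : R) :
  (forall l i j, B l i j != 0 -> a i + b j <= mu) -> tuple_norm B = 1 ->
  \sum_i a i ^+ 2 + \sum_j b j ^+ 2 <= 1 -> \sum_i a i = 0 -> \sum_j b j = 0 ->
  - mu <= moment_norm B.
Proof.
move=> hmu /tuple_norm1 h1 hab a0 b0.
pose u k := match k with inl i => a i | inr j => b j end.
pose x k := match k with inl i => complex.Re ((moment B - (n%:R^-1)%:M) i i)
  | inr j => complex.Re ((moment (adj_tuple B) - (m%:R^-1)%:M) j j) end.
have /(cauchy_schwarz_ball (moment_norm_ge0 B)) : \sum_k u k ^+ 2 <= 1.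
  by rewrite big_sum_split.
move=> /(_ x); rewrite lerNl => h; apply: le_trans (h _); last first.
  by rewrite big_sum_split moment_normE_sum lerD // sqr_diag_le.
rewrite lerN2 big_sum_split /=.
under eq_bigr do rewrite invn_complex Re_diag_moment_shift mulrBr.
under [X in _ + X]eq_bigr do rewrite invn_complex Re_diag_moment_shift mulrBr.
rewrite !sumrB -!mulr_suml a0 b0 !mul0r !subr0.
under [X in _ + X]eq_bigr do under eq_bigr do rewrite mass_adj.
rewrite trace_moment_weight -[mu]mulr1 -h1 mulr_sumr; apply: ler_sum => i _.
rewrite mulr_sumr; apply: ler_sum => j _.
have [[l hl]|hn] := pselect (exists l, B l i j != 0).
  by rewrite ler_wpM2r ?mass_ge0 // (hmu l).
rewrite mass_eq0 ?mulr0 // => l; apply/eqP; apply: contraPT hn => hl.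
by move=> []; exists l.
Qed.

(** A nonzero entry (i, j) of T B S^* needs indices q, k with [T i q], [B l q k] and [S j k] all
    nonzero; then a_i + b_j <= a_q + b_k <= mu. *)
Lemma support_triangular (R : realType) (n m N : nat) (T : 'M[R[i]]_n)
    (B : 'I_N -> 'M[R[i]]_(n, m)) (S : 'M[R[i]]_m) (a : 'I_n -> R) (b : 'I_m -> R) mu :
  (forall i k, T i k != 0 -> a i <= a k) -> (forall j k, S j k != 0 -> b j <= b k) ->
  (forall l i j, B l i j != 0 -> a i + b j <= mu) ->
  forall l i j, tuple_act T B S l i j != 0 -> a i + b j <= mu.
Proof.
move=> hT hS hB l i j; apply: contraNT; rewrite -ltNge => hlt.
rewrite /tuple_act mxE big1 // => k _; rewrite mxE mulr_suml big1 // => q _.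
rewrite adjmxE; have [->|hk] := eqVneq (T i q) 0; first by rewrite !mul0r.
have [->|hj] := eqVneq (S j k) 0; first by rewrite rmorph0 mulr0.
have [->|hb] := eqVneq (B l q k) 0; first by rewrite mulr0 mul0r.
move: (hT _ _ hk) (hS _ _ hj) (hB _ _ _ hb) hlt => h1 h2 h3.
by rewrite ltNge (le_trans _ h3) // lerD.
Qed.

Lemma weak_duality (R : realType) (n m N : nat) (A : 'I_N -> 'M[R[i]]_(n, m))
    (g sigma : 'M[R[i]]_n) (h tau : 'M[R[i]]_m) (a : 'I_n -> R) (b : 'I_m -> R) mu :
  tuple_norm (tuple_act g A h) = 1 ->
  sigma \is unitarymx -> tau \is unitarymx ->
  (forall l i j, tuple_act sigma A tau l i j != 0 -> a i + b j <= mu) ->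
  \sum_i a i ^+ 2 + \sum_j b j ^+ 2 <= 1 -> \sum_i a i = 0 -> \sum_j b j = 0 ->
  - mu <= moment_norm (tuple_act g A h).
Proof.
move=> h1 hs ht hmu hab a0 b0.
have [U [T [hU gE hT]]] := flag_qr (g *m sigma ^t*) a.
have [V [S [hV hE hS]]] := flag_qr (h *m tau ^t*) b.
pose B := tuple_act T (tuple_act sigma A tau) S.
have E : tuple_act g A h = tuple_act U B V.
  rewrite /B (tuple_actM U T) -gE -hE tuple_actM -(mulmxA g) -(mulmxA h).
  by rewrite (unitarymxPV hs) (unitarymxPV ht) !mulmx1.
rewrite E (moment_norm_unitary _ hU hV).
apply: (weight_bound (support_triangular hT hS hmu) _ hab a0 b0).
by rewrite -(tuple_norm_unitary B hU hV) -E.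
Qed.

(** * First-order conditions for sums of exponentials *)

(** This is the limit t -> 0, obtained from a single explicit value of t. *)
Lemma affine_ge0_at0 (R : realFieldType) (S K : R) :
  (forall t, 0 < t <= 1 -> 0 <= S + t * K) -> 0 <= S.
Proof.
move=> h; rewrite leNgt; apply/negP => S0.
have D0 : 0 < 1 - S + `|K| by rewrite ltr_wpDr // subr_gt0 (lt_trans S0).
(* If S < 0, this t lies in ]0, 1] and S + t K has the sign of S (1 - S + |K| - K), which is
   negative. *)
have := h (- S / (1 - S + `|K|)).
rewrite divr_gt0 ?oppr_gt0 //= ler_pdivrMr // mul1r.
have -> : - S <= 1 - S + `|K| by rewrite -addrA addrCA lerDl addr_ge0.
move=> /(_ isT); rewrite leNgt; case/negP.
rewrite -subr_gt0 -(pmulr_rgt0 _ D0).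
have -> : (1 - S + `|K|) * (0 - (S + - S / (1 - S + `|K|) * K)) =
  - S * (1 - S + (`|K| - K)) by field; rewrite gt_eqF.
by rewrite mulr_gt0 ?oppr_gt0 // ltr_wpDr ?subr_ge0 ?ler_norm // subr_gt0 (lt_trans S0).
Qed.

(** The tangent inequality 1 - x <= e^(-x), multiplied by e^x. *)
Lemma expR_sub1_le (R : realType) (x : R) : expR x - 1 <= x * expR x.
Proof.
have := expR_ge1Dx (- x); rewrite expRN => h.
have := expR_gt0 x => e0.
have : (1 - x) * expR x <= (expR x)^-1 * expR x by rewrite ler_wpM2r // ltW.
by rewrite mulVf ?gt_eqF // => h1; lra.
Qed.

(** An upper bound affine in t, so that a derivative at 0 can be read off by [affine_ge0_at0]. For d
    >= 0 it uses e^(t d) <= e^d; for d < 0 the tangent bound on e^(t d) is multiplied by the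
    negative d. *)
Lemma mul_expR_le (R : realType) (d t : R) : 0 <= t <= 1 ->
  d * expR (t * d) <= d + t * (d ^+ 2 * expR `|d|).
Proof.
move=> /andP[t0 t1]; have [d0|d0] := leP 0 d.
  rewrite ger0_norm //.
  have h1 := expR_sub1_le (t * d).
  have h2 : expR (t * d) <= expR d by rewrite ler_expR ler_piMl.
  have h3 : t * d * expR (t * d) <= t * d * expR d by rewrite ler_wpM2l // mulr_ge0.
  have h4 : d * (expR (t * d) - 1) <= d * (t * d * expR d).
    by rewrite ler_wpM2l // (le_trans h1).
  by rewrite expr2; lra.
have h1 := expR_ge1Dx (t * d).
have h2 : 1 <= expR `|d| by rewrite -expR0 ler_expR.
have h3 : d * expR (t * d) <= d * (1 + t * d) by rewrite ler_wnM2l // ltW.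
have h4 : 0 <= t * d ^+ 2 * (expR `|d| - 1).
  by rewrite mulr_ge0 ?subr_ge0 // mulr_ge0 // sqr_ge0.
by lra.
Qed.

(** The right derivative at t = 0 of a function minimal there is nonnegative. The difference
    quotient is at most this derivative plus t times a constant, which replaces differentiation. *)
Lemma expsum_first_order (R : realType) (I : finType) (c w d : I -> R) :
  (forall k, 0 <= c k) ->
  (forall t, 0 < t <= 1 ->
    \sum_k c k * expR (w k) <= \sum_k c k * expR (w k + t * d k)) ->
  0 <= \sum_k c k * expR (w k) * d k.
Proof.
move=> c0 h; apply: (@affine_ge0_at0 _ _
  (\sum_k c k * expR (w k) * (d k ^+ 2 * expR `|d k|))) => t t01.
have t0 : 0 < t by case/andP: t01.
have {h} := h t t01; rewrite -subr_ge0 -sumrB => h.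
rewrite -(pmulr_rge0 _ t0) (le_trans h) // mulr_sumr -big_split mulr_sumr.
apply: ler_sum => k _ /=; rewrite expRD.
have cw : 0 <= c k * expR (w k) by rewrite mulr_ge0 ?expR_ge0.
have h1 := expR_sub1_le (t * d k).
have t01' : 0 <= t <= 1 by rewrite ltW //; case/andP: t01.
have h2 := mul_expR_le (d k) t01'.
have h3 : t * (d k * expR (t * d k)) <= t * (d k + t * (d k ^+ 2 * expR `|d k|)).
  by rewrite ler_pM2l.
have h4 : expR (t * d k) - 1 <= t * (d k + t * (d k ^+ 2 * expR `|d k|)) by lra.
by have := ler_wpM2l cw h4; lra.
Qed.

(** The sum is convex in s and its slope at [r] is nonpositive, so on [0, r] it never exceeds its
    value at 0. *)
Lemma expsum_decay (R : realType) (I : finType) (c v : I -> R) (r s : R) :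
  (forall k, 0 <= c k) -> \sum_k c k * expR (r * v k) * v k <= 0 ->
  0 <= s <= r -> \sum_k c k * expR (s * v k) <= \sum_k c k.
Proof.
move=> c0 h /andP[s0 sr]; rewrite -subr_le0 -sumrB.
apply: le_trans (_ : s * (\sum_k c k * expR (r * v k) * v k) <= 0); last first.
  by rewrite mulr_ge0_le0.
(* e^(s v) - 1 <= s v e^(s v) <= s v e^(r v) *)
rewrite mulr_sumr; apply: ler_sum => k _.
have h1 := expR_sub1_le (s * v k).
have h2 : s * v k * expR (s * v k) <= s * v k * expR (r * v k).
  have [v0|v0] := leP 0 (v k).
    by rewrite ler_wpM2l ?mulr_ge0 // ler_expR ler_wpM2r.
  by rewrite ler_wnM2l ?mulr_ge0_le0 ?(ltW v0) // ler_expR ler_wnM2r // ltW.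
have := ler_wpM2l (c0 k) (le_trans h1 h2); lra.
Qed.

(* [p] minimises the linear form [f] over the unit ball, but only its comparison
   with the minimiser [- f / K] is needed. *)
Lemma ball_linear_min (R : rcfType) (I : finType) (f p : I -> R) (K : R) :
  K = Num.sqrt (\sum_k f k ^+ 2) -> \sum_k p k ^+ 2 <= 1 ->
  (K != 0 -> \sum_k f k * p k <= \sum_k f k * (- f k / K)) ->
  \sum_k f k * p k <= - K /\ forall k, f k = - K * p k.
Proof.
move=> KE hp h.
have S0 : 0 <= \sum_k f k ^+ 2 by apply: sumr_ge0 => k _; exact: sqr_ge0.
have K2 : K ^+ 2 = \sum_k f k ^+ 2 by rewrite KE sqr_sqrtr.
have K0 : 0 <= K by rewrite KE sqrtr_ge0.
have zero (g : I -> R) : \sum_k g k ^+ 2 <= 0 -> forall k, g k = 0.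
  move=> hg k; have h0 : \sum_k g k ^+ 2 = 0.
    by apply/eqP; rewrite eq_le hg sumr_ge0 // => ? _; exact: sqr_ge0.
  have := psumr_eq0P (fun k _ => sqr_ge0 (g k)) h0 => /(_ k isT).
  by move=> /eqP; rewrite sqrf_eq0 => /eqP.
have [E|KN0] := eqVneq K 0.
  have f0 : forall k, f k = 0 by apply: zero; rewrite -K2 E expr0n.
  rewrite E oppr0; split=> [|k]; last by rewrite f0 mul0r.
  by rewrite big1 // => k _; rewrite f0 mul0r.
have h1 : \sum_k f k * p k <= - K.
  apply: le_trans (h KN0) _.
  have -> : \sum_k f k * (- f k / K) = - ((\sum_k f k ^+ 2) / K).
    by rewrite mulr_suml -sumrN; apply: eq_bigr => k _; field.
  by rewrite -K2 expr2 mulfK.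
(* Equality case of Cauchy-Schwarz: the sum of squares is at most K^2 - 2 K^2 + K^2. *)
split=> // k; suff /zero/(_ k)/eqP : \sum_k (f k + K * p k) ^+ 2 <= 0.
  by rewrite addr_eq0 mulNr => /eqP.
have -> : \sum_k (f k + K * p k) ^+ 2 =
    \sum_k f k ^+ 2 + 2 * K * \sum_k f k * p k + K ^+ 2 * \sum_k p k ^+ 2.
  by rewrite !mulr_sumr -!big_split /=; apply: eq_bigr => j _; ring.
have h2 : K ^+ 2 * \sum_k p k ^+ 2 <= K ^+ 2 by rewrite ler_piMr // sqr_ge0.
have h3 : K * \sum_k f k * p k <= K * - K by rewrite ler_wpM2l.
by rewrite -K2; lra.
Qed.

(** * Reflections *)

Lemma ReD (R : rcfType) (x y : R[i]) :
  complex.Re (x + y) = complex.Re x + complex.Re y.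
Proof. by case: x y => [? ?] [? ?]. Qed.

Lemma Re_realM (R : rcfType) (k : R) (x : R[i]) :
  complex.Re (k%:C * x) = k * complex.Re x.
Proof. by case: x => [x y] /=; rewrite mul0r subr0. Qed.

Lemma Re_conjc (R : rcfType) (x : R[i]) : complex.Re (conjc x) = complex.Re x.
Proof. by case: x. Qed.

(** The reflection in the hyperplane orthogonal to [v] when k = 2 / |v|^2; keeping [k] apart avoids
    normalising [v]. *)
Definition householder (R : realType) (p : nat) (k : R) (v : 'cV[R[i]]_p) : 'M[R[i]]_p :=
  1%:M - k%:C *: (v *m v ^t*).

Lemma householderE (R : realType) (p : nat) k (v : 'cV[R[i]]_p) a b :
  householder k v a b = (a == b)%:R - k%:C * (v a 0 * Num.conj (v b 0)).
Proof. by rewrite !mxE big_ord1 !mxE. Qed.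

Lemma householder_adj (R : realType) (p : nat) k (v : 'cV[R[i]]_p) :
  (householder k v) ^t* = householder k v.
Proof.
apply/matrixP => a b; rewrite adjmxE !householderE !conjCE eq_sym.
rewrite rmorphB rmorph_nat 2!rmorphM /= oppr0.
by rewrite conjcK [v a 0 * _]mulrC.
Qed.

Lemma householder_unitary (R : realType) (p : nat) (k : R) (v : 'cV[R[i]]_p) :
  k * \sum_q sqnormc (v q 0) = 2 -> householder k v \is unitarymx.
Proof.
move=> hk; apply/unitarymxP; rewrite householder_adj /householder.
have vv : v ^t* *m v = (\sum_q sqnormc (v q 0))%:C%:M.
  apply/matrixP => a b; rewrite !ord1 mxE rmorph_sum [RHS]mxE eqxx mulr1n.
  by apply: eq_bigr => q _; rewrite adjmxE mulrC -sqnormcC.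
have PP : (v *m v ^t*) *m (v *m v ^t*) = (\sum_q sqnormc (v q 0))%:C *: (v *m v ^t*).
  by rewrite mulmxA -(mulmxA v) vv mul_mx_scalar -scalemxAl.
rewrite mulmxBl mul1mx mulmxBr mulmx1 -scalemxAl -scalemxAr PP !scalerA -mulrA.
rewrite -(rmorphM (real_complex R)) hk.
have -> : k%:C * 2%:C = k%:C + k%:C :> R[i].
  by rewrite -rmorphM -rmorphD mulr_natr mulr2n.
by rewrite scalerDl opprB addrK subrK.
Qed.

(** As M is Hermitian, the two terms linear in [k] of the expanded product are conjugate on the
    diagonal, whence the factor 2 and the real part. *)
Lemma householder_conj_diag (R : realType) (p : nat) (k : R) (v : 'cV[R[i]]_p)
    (M : 'M[R[i]]_p) a :
  M ^t* = M ->
  complex.Re ((householder k v *m M *m (householder k v) ^t*) a a) =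
  complex.Re (M a a) - 2 * k * complex.Re (Num.conj (v a 0) * (M *m v) a 0)
    + k ^+ 2 * sqnormc (v a 0) * complex.Re ((v ^t* *m M *m v) 0 0).
Proof.
move=> hM; rewrite householder_adj /householder.
set V := v *m v ^t*.
have -> : (1%:M - k%:C *: V) *m M *m (1%:M - k%:C *: V) =
   M - k%:C *: (M *m V) - k%:C *: (V *m M) + (k ^+ 2)%:C *: (V *m M *m V).
  rewrite mulmxBr mulmx1 mulmxBl mul1mx mulmxBl -!scalemxAl -!scalemxAr.
  rewrite scalerA -rmorphM -expr2 opprB.
  move: (k%:C *: (M *m V)) (k%:C *: (V *m M)) (_ *: (V *m M *m V)) => X Y Z.
  by rewrite [Z - X]addrC addrA (addrAC M).
have E1 : (M *m V) a a = Num.conj (v a 0) * (M *m v) a 0.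
  by rewrite /V mulmxA mxE big_ord1 adjmxE mulrC.
have E2 : (V *m M) a a = Num.conj (Num.conj (v a 0) * (M *m v) a 0).
  rewrite -E1 -adjmxE adjmxM hM; congr ((_ *m _) a a).
  by rewrite /V adjmxM adjmxK.
have E3 : (V *m M *m V) a a = (sqnormc (v a 0))%:C * (v ^t* *m M *m v) 0 0.
  rewrite /V -(mulmxA v) -(mulmxA v) mulmxA -mulmxA mxE big_ord1.
  rewrite mulmxA [X in _ * X]mxE big_ord1 adjmxE mulrCA sqnormcC.
  by rewrite [LHS]mulrC [X in X * _]mulrC.
move: ((M *m v) a 0) ((v ^t* *m M *m v) 0 0) E1 E2 E3 => y s.
move: (M *m V) (V *m M) (V *m M *m V) => X Y Z E1 E2 E3.
rewrite !mxE E1 E2 E3 ReD !ReB !Re_realM !conjCE Re_conjc; ring.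
Qed.

Lemma hermitian_diag_Im (R : rcfType) (p : nat) (M : 'M[R[i]]_p) a :
  M ^t* = M -> complex.Im (M a a) = 0.
Proof.
move=> /matrixP /(_ a a); rewrite adjmxE conjCE; case: (M a a) => x y [] /= /eqP.
by rewrite eq_sym -addr_eq0 -mulr2n mulrn_eq0 => /eqP.
Qed.

Lemma sum_two_points (R : nmodType) (p : nat) (i i' : 'I_p) (F : 'I_p -> R) :
  i != i' -> (forall k, k != i -> k != i' -> F k = 0) -> \sum_k F k = F i + F i'.
Proof.
move=> ii' h; rewrite (bigD1 i) //= (bigD1 i') ?[i' == i]eq_sym //=.
by rewrite big1 ?addr0 // => k /andP[]; exact: h.
Qed.

(* The reflection along t z e_i + e_i' is, up to the sign of one row, a rotation
   in the plane (i, i') by an angle of order t. *)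
Lemma reflection_diag (R : realType) (p : nat) (M : 'M[R[i]]_p) (i i' : 'I_p)
    (z : R[i]) (t : R) :
  M ^t* = M -> i != i' -> sqnormc z = 1 ->
  exists2 U : 'M[R[i]]_p, U \is unitarymx & forall d : 'I_p -> R,
    (1 + t ^+ 2) ^+ 2 * (\sum_k d k * complex.Re ((U *m M *m U ^t*) k k)
                         - \sum_k d k * complex.Re (M k k)) =
    4 * (d i - d i') * (t * (t * (complex.Re (M i' i') - complex.Re (M i i))
                   - complex.Re (Num.conj z * M i i') * (1 - t ^+ 2))).
Proof.
move=> hM ii' hz.
pose v : 'cV[R[i]]_p := \col_k (if k == i then t%:C * z else if k == i' then 1 else 0).
have vi : v i 0 = t%:C * z by rewrite mxE eqxx.
have vi' : v i' 0 = 1 by rewrite mxE eq_sym (negbTE ii') eqxx.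
have v0 k : k != i -> k != i' -> v k 0 = 0.
  by move=> /negbTE k1 /negbTE k2; rewrite mxE k1 k2.
have N0 : 1 + t ^+ 2 != 0 by rewrite gt_eqF // ltr_wpDr ?sqr_ge0.
(* Here |v|^2 = 1 + t^2, since z has modulus 1. *)
pose k := 2 / (1 + t ^+ 2).
have svi : sqnormc (v i 0) = t ^+ 2.
  rewrite vi -[RHS]mulr1 -hz; case: (z) => x y; rewrite /sqnormc /=; ring.
have svi' : sqnormc (v i' 0) = 1.
  by rewrite vi' /sqnormc /= expr1n expr0n addr0.
have hU : householder k v \is unitarymx.
  apply: householder_unitary; rewrite (sum_two_points ii') ?svi ?svi' //.
    by rewrite /k; field.
  by move=> j ji ji'; rewrite v0 // sqnormc0.
exists (householder k v) => // d.
have Mv a : (M *m v) a 0 = M a i * (t%:C * z) + M a i'.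
  rewrite mxE (sum_two_points ii') ?vi ?vi' ?mulr1 //.
  by move=> j ji ji'; rewrite v0 // mulr0.
pose P := complex.Re (M i i); pose Q := complex.Re (M i' i').
pose w := complex.Re (Num.conj z * M i i').
have Mc : M i' i = conjc (M i i') by rewrite -conjCE -adjmxE hM.
have e1 : complex.Re (Num.conj (v i 0) * (M *m v) i 0) = t ^+ 2 * P + t * w.
  rewrite Mv vi /P /w; have := hermitian_diag_Im i hM.
  rewrite -[X in X * P]mulr1 -hz /P !conjCE; case: (M i i) => m1 m2 /= ->.
  case: (M i i') => w1 w2; case: (z) => z1 z2; rewrite /sqnormc /=; ring.
have e2 : complex.Re (Num.conj (v i' 0) * (M *m v) i' 0) = t * w + Q.
  rewrite Mv vi' Mc /Q /w rmorph1 mul1r !conjCE.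
  case: (M i i') => w1 w2; case: (z) => z1 z2; case: (M i' i') => q1 q2 /=; ring.
have e3 : complex.Re ((v ^t* *m M *m v) 0 0) = t ^+ 2 * P + 2 * t * w + Q.
  rewrite -mulmxA mxE (sum_two_points ii').
    by rewrite !adjmxE ReD e1 e2; ring.
  by move=> j ji ji'; rewrite adjmxE v0 // rmorph0 mul0r.
(* The vector [v] vanishes outside i and i', so the other diagonal entries do not change. *)
rewrite -sumrB (sum_two_points ii') => [|j ji ji']; last first.
  rewrite householder_conj_diag // v0 // sqnormc0 rmorph0 mul0r !mulr0 mul0r.
  by rewrite addr0 subr0 subrr.
rewrite !householder_conj_diag // e1 e2 e3 svi svi' -/P -/Q -/w /k.
by field.
Qed.

(** * Minimisers of the exponential weight *)

(** The squared norm of the tuple e^(rho a / 2) sigma A tau^* e^(rho b / 2). *)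
Definition exp_weight (R : realType) (n m N : nat) (rho : R)
    (A : 'I_N -> 'M[R[i]]_(n, m)) (sigma : 'M[R[i]]_n) (tau : 'M[R[i]]_m)
    (a : 'I_n -> R) (b : 'I_m -> R) : R :=
  \sum_i \sum_j mass (tuple_act sigma A tau) i j * expR (rho * (a i + b j)).

(** Unitary rather than special unitary: this set is stable under reflections, whose determinant is
    -1. [unitary_phase] restores determinant 1 at the end. *)
Definition feasible (R : realType) (n m : nat) (sigma : 'M[R[i]]_n)
    (tau : 'M[R[i]]_m) (a : 'I_n -> R) (b : 'I_m -> R) : Prop :=
  [/\ sigma \is unitarymx, tau \is unitarymx, \sum_i a i = 0, \sum_j b j = 0 &
      \sum_i a i ^+ 2 + \sum_j b j ^+ 2 <= 1].

Definition minimizer (R : realType) (n m N : nat) (rho : R)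
    (A : 'I_N -> 'M[R[i]]_(n, m)) sigma tau (a : 'I_n -> R) (b : 'I_m -> R) : Prop :=
  feasible sigma tau a b /\
  forall sigma' tau' a' b', feasible sigma' tau' a' b' ->
    exp_weight rho A sigma tau a b <= exp_weight rho A sigma' tau' a' b'.

Lemma exp_weight_adj (R : realType) (n m N : nat) (rho : R)
    (A : 'I_N -> 'M[R[i]]_(n, m)) sigma tau (a : 'I_n -> R) (b : 'I_m -> R) :
  exp_weight rho (adj_tuple A) tau sigma b a = exp_weight rho A sigma tau a b.
Proof.
rewrite /exp_weight exchange_big; apply: eq_bigr => i _; apply: eq_bigr => j _.
by rewrite -adj_tuple_act mass_adj [b j + _]addrC.
Qed.

Lemma feasible_swap (R : realType) (n m : nat) (sigma : 'M[R[i]]_n)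
    (tau : 'M[R[i]]_m) (a : 'I_n -> R) (b : 'I_m -> R) :
  feasible sigma tau a b -> feasible tau sigma b a.
Proof. by case=> ? ? ? ? h; split=> //; rewrite addrC. Qed.

Lemma minimizer_adj (R : realType) (n m N : nat) (rho : R)
    (A : 'I_N -> 'M[R[i]]_(n, m)) sigma tau (a : 'I_n -> R) (b : 'I_m -> R) :
  minimizer rho A sigma tau a b -> minimizer rho (adj_tuple A) tau sigma b a.
Proof.
move=> [hf hmin]; split; first exact: feasible_swap.
move=> tau' sigma' b' a' /feasible_swap /hmin.
by rewrite !exp_weight_adj.
Qed.

Lemma sqr_convex (R : realFieldType) (t x y : R) : 0 <= t <= 1 ->
  (x + t * (y - x)) ^+ 2 <= (1 - t) * x ^+ 2 + t * y ^+ 2.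
Proof.
move=> /andP[t0 t1]; have : 0 <= t * (1 - t) * (y - x) ^+ 2.
  by rewrite mulr_ge0 ?sqr_ge0 // mulr_ge0 // subr_ge0.
by rewrite !expr2; lra.
Qed.

Lemma feasible_segment (R : realType) (n m : nat) (sigma : 'M[R[i]]_n)
    (tau : 'M[R[i]]_m) (a a' : 'I_n -> R) (b b' : 'I_m -> R) t : 0 <= t <= 1 ->
  feasible sigma tau a b -> feasible sigma tau a' b' ->
  feasible sigma tau (fun i => a i + t * (a' i - a i)) (fun j => b j + t * (b' j - b j)).
Proof.
move=> t01 [hs ht a0 b0 hab] [_ _ a0' b0' hab']; split=> //.
- by rewrite big_split /= -mulr_sumr sumrB a0 a0' subr0 mulr0 addr0.
- by rewrite big_split /= -mulr_sumr sumrB b0 b0' subr0 mulr0 addr0.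
apply: (@le_trans _ _ ((1 - t) * (\sum_i a i ^+ 2 + \sum_j b j ^+ 2) +
    t * (\sum_i a' i ^+ 2 + \sum_j b' j ^+ 2))).
  rewrite !mulrDr addrACA !mulr_sumr -!big_split lerD //;
    by apply: ler_sum => k _; exact: sqr_convex.
by case/andP: t01 => t0 t1; nra.
Qed.

(** On the segment from (a, b) to (a', b') the weight is minimal at the start, so its derivative
    there, which is rho times the right side minus the left side, is nonnegative. *)
Lemma row_mass_first_order (R : realType) (n m N : nat) (rho : R)
    (A : 'I_N -> 'M[R[i]]_(n, m)) sigma tau (a a' : 'I_n -> R) (b b' : 'I_m -> R) :
  0 < rho -> minimizer rho A sigma tau a b -> feasible sigma tau a' b' ->
  let E i j := mass (tuple_act sigma A tau) i j * expR (rho * (a i + b j)) in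
  \sum_i a i * (\sum_j E i j) + \sum_j b j * (\sum_i E i j) <=
  \sum_i a' i * (\sum_j E i j) + \sum_j b' j * (\sum_i E i j).
Proof.
move=> r0 [hf hmin] hf'; cbv zeta; set E := fun i j => _ * _.
have h : 0 <= \sum_(k : 'I_n * 'I_m) E k.1 k.2 * (rho * ((a' k.1 - a k.1) + (b' k.2 - b k.2))).
  apply: expsum_first_order => [k|t t01]; first exact: mass_ge0.
  have t01' : 0 <= t <= 1 by case/andP: t01 => t0 ->; rewrite ltW.
  have := hmin _ _ _ _ (feasible_segment t01' hf hf').
  rewrite /exp_weight !pair_big /= => /le_trans -> //.
  apply: ler_sum => k _; rewrite le_eqVlt; apply/orP; left; apply/eqP.
  by congr (_ * expR _); ring.
have swapE (c : 'I_n -> R) (d : 'I_m -> R) :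
    \sum_i c i * (\sum_j E i j) + \sum_j d j * (\sum_i E i j) =
    \sum_(k : 'I_n * 'I_m) E k.1 k.2 * (c k.1 + d k.2).
  under eq_bigr do rewrite mulr_sumr.
  under [X in _ + X]eq_bigr do rewrite mulr_sumr.
  rewrite [X in _ + X]exchange_big !pair_big -big_split; apply: eq_bigr => k _ /=.
  ring.
rewrite !swapE -subr_ge0 -sumrB -(pmulr_rge0 _ r0) (le_trans h) // mulr_sumr.
by apply: ler_sum => k _; rewrite le_eqVlt; apply/orP; left; apply/eqP; ring.
Qed.

Definition row_weight (R : realType) (n m N : nat) (rho : R)
    (A : 'I_N -> 'M[R[i]]_(n, m)) sigma tau (a : 'I_n -> R) (b : 'I_m -> R) i : R :=
  \sum_j mass (tuple_act sigma A tau) i j * expR (rho * (a i + b j)).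

Lemma row_weight_adj (R : realType) (n m N : nat) (rho : R)
    (A : 'I_N -> 'M[R[i]]_(n, m)) sigma tau (a : 'I_n -> R) (b : 'I_m -> R) j :
  row_weight rho (adj_tuple A) tau sigma b a j =
  \sum_i mass (tuple_act sigma A tau) i j * expR (rho * (a i + b j)).
Proof.
by apply: eq_bigr => i _; rewrite -adj_tuple_act mass_adj [b j + _]addrC.
Qed.

(* The diagonals of the two components of the shifted moment of the tuple
   e^(rho a / 2) sigma A tau^* e^(rho b / 2), scaled to norm 1. *)
Definition diag_gradient (R : realType) (n m N : nat) (rho : R)
    (A : 'I_N -> 'M[R[i]]_(n, m)) sigma tau (a : 'I_n -> R) (b : 'I_m -> R)
    (k : 'I_n + 'I_m) : R :=
  match k with
  | inl i => row_weight rho A sigma tau a b i / exp_weight rho A sigma tau a b - n%:R^-1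
  | inr j => row_weight rho (adj_tuple A) tau sigma b a j
               / exp_weight rho A sigma tau a b - m%:R^-1
  end.

Lemma sum_row_weight (R : realType) (n m N : nat) (rho : R)
    (A : 'I_N -> 'M[R[i]]_(n, m)) sigma tau (a : 'I_n -> R) (b : 'I_m -> R) :
  \sum_i row_weight rho A sigma tau a b i = exp_weight rho A sigma tau a b.
Proof. by []. Qed.

(** Divided by the weight, the row weights sum to 1, and so do the n shifts 1/n. The gradient is
    therefore itself traceless, and its multiples are admissible directions. *)
Lemma sum_diag_gradient (R : realType) (n m N : nat) (rho : R)
    (A : 'I_N -> 'M[R[i]]_(n, m)) sigma tau (a : 'I_n -> R) (b : 'I_m -> R) :
  (0 < n)%N -> (0 < m)%N -> 0 < exp_weight rho A sigma tau a b ->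
  \sum_i diag_gradient rho A sigma tau a b (inl i) = 0 /\
  \sum_j diag_gradient rho A sigma tau a b (inr j) = 0.
Proof.
move=> n0 m0 F0; split;
  rewrite /= sumrB -mulr_suml sum_row_weight ?exp_weight_adj divff ?gt_eqF //;
  by rewrite sumr_const card_ord -[_ *+ _]mulr_natl divff ?subrr // pnatr_eq0 -lt0n.
Qed.

Lemma diag_gradient_pairing (R : realType) (n m N : nat) (rho : R)
    (A : 'I_N -> 'M[R[i]]_(n, m)) sigma tau (a : 'I_n -> R) (b : 'I_m -> R)
    (c : 'I_n -> R) (d : 'I_m -> R) :
  \sum_i c i = 0 -> \sum_j d j = 0 ->
  \sum_i c i * diag_gradient rho A sigma tau a b (inl i) +
    \sum_j d j * diag_gradient rho A sigma tau a b (inr j) =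
  (\sum_i c i * row_weight rho A sigma tau a b i +
   \sum_j d j * row_weight rho (adj_tuple A) tau sigma b a j)
    / exp_weight rho A sigma tau a b.
Proof.
move=> c0 d0 /=.
under eq_bigr do rewrite mulrBr mulrA.
under [X in _ + X]eq_bigr do rewrite mulrBr mulrA.
by rewrite !sumrB -!mulr_suml c0 d0 !mul0r !subr0 -mulrDl.
Qed.

(** By the first-order condition, (a, b) minimises the linear form f over the traceless part of the
    unit ball. Since - f / K belongs to it, the minimum is - K, and equality in Cauchy-Schwarz makes
    f a multiple of (a, b). *)
Lemma minimizer_diag_gradient (R : realType) (n m N : nat) (rho : R)
    (A : 'I_N -> 'M[R[i]]_(n, m)) sigma tau (a : 'I_n -> R) (b : 'I_m -> R) :
  (0 < n)%N -> (0 < m)%N -> 0 < rho -> minimizer rho A sigma tau a b ->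
  0 < exp_weight rho A sigma tau a b ->
  let f := diag_gradient rho A sigma tau a b in
  let K := Num.sqrt (\sum_k f k ^+ 2) in
  \sum_i a i * f (inl i) + \sum_j b j * f (inr j) <= - K /\
  (forall i, f (inl i) = - K * a i).
Proof.
move=> n0 m0 r0 hmin F0; cbv zeta; set f := diag_gradient _ _ _ _ _ _; set K := Num.sqrt _.
have [f1 f2] := sum_diag_gradient n0 m0 F0; rewrite -/f in f1 f2.
pose p k := match k with inl i => a i | inr j => b j end.
have [hs ht a0 b0 hab] := hmin.1.
have S0 : 0 <= \sum_k f k ^+ 2 by apply: sumr_ge0 => k _; exact: sqr_ge0.
have K2 : K ^+ 2 = \sum_k f k ^+ 2 by rewrite sqr_sqrtr.
have pair_f := diag_gradient_pairing rho A sigma tau a b; rewrite -/f in pair_f.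
have [||h1 h2] := @ball_linear_min _ _ f p K erefl.
- by rewrite big_sum_split.
- move=> KN0; pose a' i := - f (inl i) / K; pose b' j := - f (inr j) / K.
  have a'0 : \sum_i a' i = 0 by rewrite -mulr_suml sumrN f1 oppr0 mul0r.
  have b'0 : \sum_j b' j = 0 by rewrite -mulr_suml sumrN f2 oppr0 mul0r.
  have hf' : feasible sigma tau a' b'.
    split=> //; rewrite le_eqVlt; apply/orP; left; apply/eqP.
    under eq_bigr do rewrite exprMn sqrrN.
    under [X in _ + X]eq_bigr do rewrite exprMn sqrrN.
    rewrite -!mulr_suml -mulrDl -(big_sum_split (fun k => f k ^+ 2)) -K2.
    by rewrite -exprMn divff // expr1n.
  have := row_mass_first_order r0 hmin hf'; cbv zeta => h.
  rewrite !big_sum_split /=.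
  under eq_bigr do rewrite mulrC.
  under [X in _ + X <= _]eq_bigr do rewrite mulrC.
  under [X in _ <= X + _]eq_bigr do rewrite mulrC.
  under [X in _ <= _ + X]eq_bigr do rewrite mulrC.
  rewrite (pair_f a b) // (pair_f a' b') // ler_pM2r ?invr_gt0 //.
  under [X in _ + X <= _]eq_bigr do rewrite row_weight_adj.
  under [X in _ <= _ + X]eq_bigr do rewrite row_weight_adj.
  exact: h.
split=> [|i]; last exact: h2 (inl i).
move: h1; rewrite big_sum_split /=.
under eq_bigr do rewrite mulrC.
by under [X in _ + X <= _]eq_bigr do rewrite mulrC.
Qed.

(** * Rescaling by real diagonal matrices *)

Definition rdiag (R : realType) (p : nat) (x : 'I_p -> R) : 'M[R[i]]_p :=
  diag_mx (\row_i (x i)%:C).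

Lemma rdiag_adj (R : realType) (p : nat) (x : 'I_p -> R) : (rdiag x) ^t* = rdiag x.
Proof.
rewrite /rdiag tr_diag_mx map_diag_mx; congr diag_mx; apply/rowP => k.
by rewrite !mxE; exact: conjc_real.
Qed.

Lemma rdiag_unit (R : realType) (p : nat) (x : 'I_p -> R) :
  (forall k, x k != 0) -> rdiag x \in unitmx.
Proof.
move=> h; rewrite unitmxE det_diag unitfE; apply/prodf_neq0 => k _.
by rewrite mxE fmorph_eq0.
Qed.

Lemma rdiag_actE (R : realType) (n m N : nat) (x : 'I_n -> R)
    (C : 'I_N -> 'M[R[i]]_(n, m)) (y : 'I_m -> R) l i j :
  tuple_act (rdiag x) C (rdiag y) l i j = (x i * y j)%:C * C l i j.
Proof.
rewrite /tuple_act rdiag_adj /rdiag mul_mx_diag mul_diag_mx !mxE.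
by rewrite mulrAC -rmorphM.
Qed.

Lemma sqnormc_scale (R : rcfType) (k : R) (z : R[i]) :
  sqnormc (k%:C * z) = k ^+ 2 * sqnormc z.
Proof. by case: z => x y; rewrite /sqnormc /=; ring. Qed.

Lemma mass_rdiag (R : realType) (n m N : nat) (x : 'I_n -> R)
    (C : 'I_N -> 'M[R[i]]_(n, m)) (y : 'I_m -> R) i j :
  mass (tuple_act (rdiag x) C (rdiag y)) i j = (x i * y j) ^+ 2 * mass C i j.
Proof.
rewrite /mass mulr_sumr; apply: eq_bigr => l _.
by rewrite rdiag_actE sqnormc_scale.
Qed.

Lemma moment_actl (R : realType) (n m N : nat) (U g : 'M[R[i]]_n)
    (A : 'I_N -> 'M[R[i]]_(n, m)) (h : 'M[R[i]]_m) :
  moment (tuple_act (U *m g) A h) = U *m moment (tuple_act g A h) *m U ^t*.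
Proof.
rewrite /moment mulmx_sumr mulmx_suml; apply: eq_bigr => l _.
have -> : tuple_act (U *m g) A h l = U *m tuple_act g A h l.
  by rewrite /tuple_act !mulmxA.
by rewrite (adjmxM U) !mulmxA.
Qed.

Lemma moment_adj (R : realType) (n m N : nat) (B : 'I_N -> 'M[R[i]]_(n, m)) :
  (moment B) ^t* = moment B.
Proof.
rewrite /moment raddf_sum map_mx_sum; apply: eq_bigr => l _.
by rewrite (adjmxM (B l)) adjmxK.
Qed.

(** The exponent is halved because masses are quadratic in the tuple. *)
Definition half_exp (R : realType) (p : nat) (rho : R) (a : 'I_p -> R) (k : 'I_p) : R :=
  expR (rho / 2 * a k).

Lemma half_exp_sqr (R : realType) (p : nat) (rho : R) (a : 'I_p -> R) k :
  half_exp rho a k ^+ 2 = expR (rho * a k).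
Proof. by rewrite /half_exp expr2 -expRD; congr expR; field. Qed.

Lemma diag_moment_half_exp (R : realType) (n m N : nat) (rho : R)
    (A : 'I_N -> 'M[R[i]]_(n, m)) sigma tau (b : 'I_m -> R) i :
  complex.Re (moment (tuple_act sigma A (rdiag (half_exp rho b) *m tau)) i i) =
  \sum_j mass (tuple_act sigma A tau) i j * expR (rho * b j).
Proof.
rewrite diag_moment /=; apply: eq_bigr => j _.
have -> : tuple_act sigma A (rdiag (half_exp rho b) *m tau) =
   tuple_act (rdiag (fun=> 1)) (tuple_act sigma A tau) (rdiag (half_exp rho b)).
  rewrite tuple_actM; congr (tuple_act _ _ _).
  rewrite -[LHS]mul1mx; congr (_ *m _); apply/matrixP => k q; rewrite !mxE.
  by rewrite rmorph1.
by rewrite mass_rdiag mul1r half_exp_sqr mulrC.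
Qed.

(** The left factor e^(rho a / 2) is kept out of the moment. The weight is then linear in the
    diagonal of a Hermitian matrix, which changes by conjugation when [sigma] is multiplied on the
    left by a unitary matrix. *)
Lemma exp_weight_moment (R : realType) (n m N : nat) (rho : R)
    (A : 'I_N -> 'M[R[i]]_(n, m)) sigma tau (a : 'I_n -> R) (b : 'I_m -> R) :
  exp_weight rho A sigma tau a b = \sum_i expR (rho * a i) *
    complex.Re (moment (tuple_act sigma A (rdiag (half_exp rho b) *m tau)) i i).
Proof.
apply: eq_bigr => i _; rewrite diag_moment_half_exp mulr_sumr.
by apply: eq_bigr => j _; rewrite mulrDr expRD mulrCA.
Qed.

Lemma row_weight_moment (R : realType) (n m N : nat) (rho : R)
    (A : 'I_N -> 'M[R[i]]_(n, m)) sigma tau (a : 'I_n -> R) (b : 'I_m -> R) i :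
  row_weight rho A sigma tau a b i = expR (rho * a i) *
    complex.Re (moment (tuple_act sigma A (rdiag (half_exp rho b) *m tau)) i i).
Proof.
rewrite diag_moment_half_exp mulr_sumr.
by apply: eq_bigr => j _; rewrite mulrDr expRD mulrCA.
Qed.

(** To first order in t the expression is - w t; small t of both signs force w = 0. *)
Lemma quadratic_slope0 (R : realFieldType) (e w : R) :
  (forall t, 0 <= t * (t * e - w * (1 - t ^+ 2))) -> w = 0.
Proof.
move=> h.
have key (u : R) : (forall t, 0 <= t * (t * e - u * (1 - t ^+ 2))) -> 0 <= - u.
  (* For 0 < t <= 1 the constant |e| + |u| absorbs both t e and t^2 u. *)
  move=> hu; apply: (@affine_ge0_at0 _ _ (`|e| + `|u|)) => t /andP[t0 t1].
  have := hu t; rewrite pmulr_rge0 // => h1; apply: le_trans h1 _.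
  have h2 : t * e <= t * `|e| by rewrite ler_wpM2l ?ler_norm // ltW.
  have h3 : t * (t * u) <= t * `|u|.
    apply: ler_wpM2l; first exact: ltW.
    apply: (@le_trans _ _ (t * `|u|)).
      by rewrite ler_wpM2l ?ler_norm // ltW.
    by rewrite ler_piMl.
  by rewrite expr2; lra.
have := key _ h; rewrite oppr_ge0 => w0.
have := key (- w); rewrite opprK => w1; apply/eqP; rewrite eq_le w0 w1 // => t.
by have := h (- t); rewrite sqrrN; lra.
Qed.

(** Reads off an identity of the shape given by [reflection_diag]: F and F' are the weighted
    diagonal sums before and after the reflection, c and d the weights at i and i'. *)
Lemma scaled_difference (R : realFieldType) (K F F' c d q : R) :
  0 < K -> K * (F' - F) = 4 * (c - d) * q ->
  [/\ c = d -> F' = F, F <= F' -> 0 <= (c - d) * q & c - d != 0 -> F' = F -> q = 0].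
Proof.
move=> K0 E; split=> [cd|FF|cd0 FF].
- move: E; rewrite cd subrr mulr0 mul0r => /eqP.
  by rewrite mulf_eq0 gt_eqF //= subr_eq0 => /eqP.
- have : 0 <= K * (F' - F) by rewrite mulr_ge0 ?subr_ge0 // ltW.
  by rewrite E -mulrA pmulr_rge0.
- move: E; rewrite FF subrr mulr0 => /esym/eqP.
  by rewrite -mulrA !mulf_eq0 pnatr_eq0 (negbTE cd0) => /eqP.
Qed.

(* If a_i <> a_i', the first variation of the weight under reflections in the
   plane (i, i') vanishes.  If a_i = a_i', reflections preserve the weight, and the
   two diagonal entries, which are equal at every minimiser, do not vary. *)
Lemma minimizer_offdiag (R : realType) (n m N : nat) (rho : R)
    (A : 'I_N -> 'M[R[i]]_(n, m)) sigma tau (a : 'I_n -> R) (b : 'I_m -> R) i i' :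
  (0 < n)%N -> (0 < m)%N -> 0 < rho -> minimizer rho A sigma tau a b ->
  0 < exp_weight rho A sigma tau a b -> i != i' ->
  moment (tuple_act sigma A (rdiag (half_exp rho b) *m tau)) i i' = 0.
Proof.
move=> n0 m0 r0 hmin F0 ii'.
set h := rdiag _ *m tau; set M := moment _.
(* The phases z = 1 and z = i yield the real and the imaginary part of the entry. *)
suff key z : sqnormc z = 1 -> complex.Re (Num.conj z * M i i') = 0.
  have := key 1; have := key 'i; rewrite /sqnormc /= !(expr0n, expr1n) /= add0r addr0.
  move=> /(_ erefl) + /(_ erefl); rewrite !conjCE; case: (M i i') => x y /=.
  by rewrite !(mul0r, mul1r, mulN1r, oppr0, subr0, add0r, sub0r, opprK) => -> ->.
move=> hz; have hM : M ^t* = M by exact: moment_adj.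
(* The gradient is - K a at every minimiser, so a_i = a_i' gives equal row weights; dividing by the
   common exponential gives equal diagonal entries. *)
have diag_eq sigma' : minimizer rho A sigma' tau a b ->
    exp_weight rho A sigma' tau a b = exp_weight rho A sigma tau a b -> a i = a i' ->
    complex.Re (moment (tuple_act sigma' A h) i i) =
    complex.Re (moment (tuple_act sigma' A h) i' i').
  move=> hmin' hF hai; have F0' : 0 < exp_weight rho A sigma' tau a b by rewrite hF.
  have [_ hf] := minimizer_diag_gradient n0 m0 r0 hmin' F0'.
  have := hf i; rewrite hai -hf /= => /addIr.
  move=> /(mulIf (invr_neq0 (lt0r_neq0 F0'))).
  by rewrite !row_weight_moment hai => /(mulfI (lt0r_neq0 (expR_gt0 _))).
have refl t : exists2 U : 'M[R[i]]_n, U \is unitarymx & forall d : 'I_n -> R,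
    (1 + t ^+ 2) ^+ 2 * (\sum_k d k * complex.Re (moment (tuple_act (U *m sigma) A h) k k)
                         - \sum_k d k * complex.Re (M k k)) =
    4 * (d i - d i') * (t * (t * (complex.Re (M i' i') - complex.Re (M i i))
                   - complex.Re (Num.conj z * M i i') * (1 - t ^+ 2))).
  have [U hU hd] := reflection_diag t hM ii' hz; exists U => // d.
  by rewrite moment_actl -/M hd.
have N0 t : 0 < (1 + t ^+ 2) ^+ 2 :> R by rewrite exprn_gt0 // ltr_wpDr ?sqr_ge0.
have [hs ht a0 b0 hab] := hmin.1.
have feasU (U : 'M[R[i]]_n) : U \is unitarymx -> feasible (U *m sigma) tau a b.
  by move=> hU; split; [exact: unitaryM hU hs|exact: ht|exact: a0|exact: b0|exact: hab].
have EW g : exp_weight rho A g tau a b =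
    \sum_k expR (rho * a k) * complex.Re (moment (tuple_act g A h) k k).
  exact: exp_weight_moment.
(* With these test weights the diagonal sum is the difference of the entries at i and i', and d_i -
   d_i' = 2 is not zero. *)
pose d k : R := (k == i)%:R - (k == i')%:R.
have sumd0 (x : 'I_n -> R) : x i = x i' -> \sum_k d k * x k = 0.
  move=> xi; rewrite (sum_two_points ii') => [|k /negbTE k1 /negbTE k2].
    by rewrite /d !eqxx [i' == i]eq_sym (negbTE ii') subr0 sub0r mul1r mulN1r xi subrr.
  by rewrite /d k1 k2 subrr mul0r.
have d2 : d i - d i' != 0.
  rewrite /d !eqxx [i' == i]eq_sym (negbTE ii') subr0 sub0r opprK.
  by rewrite -(natrD R 1 1) pnatr_eq0.
move: (complex.Re (M i' i') - complex.Re (M i i)) (complex.Re (Num.conj z * M i i')) refl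
  => e w refl.
have var t : 0 <= (expR (rho * a i) - expR (rho * a i')) * (t * (t * e - w * (1 - t ^+ 2))) /\
    (a i = a i' -> t * (t * e - w * (1 - t ^+ 2)) = 0).
  have [U hU hd] := refl t.
  have hE : (1 + t ^+ 2) ^+ 2 *
      (exp_weight rho A (U *m sigma) tau a b - exp_weight rho A sigma tau a b) =
      4 * (expR (rho * a i) - expR (rho * a i')) * (t * (t * e - w * (1 - t ^+ 2))).
    by rewrite (EW (U *m sigma)) (EW sigma); exact: hd (fun k => expR (rho * a k)).
  have [E1 E2 _] := scaled_difference (N0 t) hE.
  have [_ _ E3] := scaled_difference (N0 t) (hd d).
  split=> [|heq]; first exact: E2 (hmin.2 _ _ _ _ (feasU _ hU)).
  have {}E1 := E1 (congr1 (fun x => expR (rho * x)) heq).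
  (* When a_i = a_i' the reflected configuration is again a minimiser, so [diag_eq] applies before
     and after the reflection. *)
  have hmin' : minimizer rho A (U *m sigma) tau a b.
    by split=> [|s' t' a' b' /hmin.2]; [exact: feasU hU|rewrite E1].
  have s1 := sumd0 (fun k => complex.Re (moment (tuple_act (U *m sigma) A h) k k))
    (diag_eq _ hmin' E1 heq).
  have s2 := sumd0 (fun k => complex.Re (M k k)) (diag_eq _ hmin erefl heq).
  exact: E3 d2 (etrans s1 (esym s2)).
have [hlt|hgt|heq] := ltgtP (a i) (a i').
- have h1 : 0 < expR (rho * a i') - expR (rho * a i).
    by rewrite subr_gt0 ltr_expR ltr_pM2l.
  (* The difference of exponentials is negative here, so the inequality is used with e and w
     negated. *)
  suff /eqP : - w = 0 by rewrite oppr_eq0 => /eqP.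
  apply: (@quadratic_slope0 _ (- e)) => t.
  rewrite -(pmulr_rge0 _ h1); have := (var t).1; lra.
- have h1 : 0 < expR (rho * a i) - expR (rho * a i').
    by rewrite subr_gt0 ltr_expR ltr_pM2l.
  by apply: (@quadratic_slope0 _ e) => t; rewrite -(pmulr_rge0 _ h1); exact: (var t).1.
by apply: (@quadratic_slope0 _ e) => t; rewrite (var t).2.
Qed.

Lemma sum_mass_trace (R : realType) (n m N : nat) (B : 'I_N -> 'M[R[i]]_(n, m)) :
  \sum_i \sum_j mass B i j = complex.Re (\tr (moment B)).
Proof. by rewrite Re_sum; apply: eq_bigr => i _; rewrite diag_moment. Qed.

Lemma sum_mass_unitary (R : realType) (n m N : nat) (U : 'M[R[i]]_n)
    (B : 'I_N -> 'M[R[i]]_(n, m)) (V : 'M[R[i]]_m) :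
  U \is unitarymx -> V \is unitarymx ->
  \sum_i \sum_j mass (tuple_act U B V) i j = \sum_i \sum_j mass B i j.
Proof.
move=> hU hV; rewrite !sum_mass_trace (moment_unitary _ _ hV).
by rewrite mxtrace_mulC mulmxA (unitarymxPV hU) mul1mx.
Qed.

Lemma moment_rdiag_offdiag (R : realType) (n m N : nat) (x : 'I_n -> R)
    (A : 'I_N -> 'M[R[i]]_(n, m)) sigma (h : 'M[R[i]]_m) i k :
  moment (tuple_act sigma A h) i k = 0 ->
  moment (tuple_act (rdiag x *m sigma) A h) i k = 0.
Proof.
move=> E; rewrite moment_actl rdiag_adj /rdiag mul_mx_diag mul_diag_mx.
by rewrite mxE [X in X * _]mxE E mulr0 mul0r.
Qed.

(** A real scalar crosses the tuple, so the normalising factor can sit on whichever side is treated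
    as the row side. *)
Lemma rdiag_act_scale (R : realType) (n m N : nat) (c : R) (x : 'I_n -> R)
    (A : 'I_N -> 'M[R[i]]_(n, m)) (y : 'I_m -> R) sigma tau :
  tuple_act (rdiag (fun i => c * x i) *m sigma) A (rdiag y *m tau) =
  tuple_act (rdiag x *m sigma) A (rdiag (fun j => c * y j) *m tau).
Proof.
rewrite -!tuple_actM; apply/funext => l; apply/matrixP => i j; rewrite !rdiag_actE.
by congr (_%:C * _); ring.
Qed.

Lemma frobenius_diag (R : realType) (p : nat) (X : 'M[R[i]]_p) (x : 'I_p -> R) :
  (forall i, X i i = (x i)%:C) -> (forall i k, i != k -> X i k = 0) ->
  \sum_i \sum_k sqnormc (X i k) = \sum_i x i ^+ 2.
Proof.
move=> hd h0; apply: eq_bigr => i _; rewrite (bigD1 i) //= big1 => [|k ki].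
  by rewrite addr0 hd /sqnormc /= expr0n addr0.
by rewrite h0 ?sqnormc0 // eq_sym.
Qed.

Lemma shifted_moment_diag (R : realType) (n m N : nat) (B : 'I_N -> 'M[R[i]]_(n, m)) :
  (forall i k, i != k -> moment B i k = 0) ->
  \sum_i \sum_k sqnormc ((moment B - (n%:R^-1)%:M) i k) =
  \sum_i (\sum_j mass B i j - n%:R^-1) ^+ 2.
Proof.
move=> h; apply: frobenius_diag => [i|i k ik].
  by rewrite mxE diag_moment [X in _ + X]mxE [X in - X]mxE eqxx invn_complex rmorphB.
by rewrite mxE h // [X in _ + X]mxE [X in - X]mxE (negbTE ik) mulr0n subrr.
Qed.

(** At a minimiser both moments of the rescaled tuple are diagonal, so the moment norm is the
    Euclidean norm of the diagonal gradient. *)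
Lemma minimizer_normalized (R : realType) (n m N : nat) (rho : R)
    (A : 'I_N -> 'M[R[i]]_(n, m)) sigma tau (a : 'I_n -> R) (b : 'I_m -> R) :
  (0 < n)%N -> (0 < m)%N -> 0 < rho -> minimizer rho A sigma tau a b ->
  0 < exp_weight rho A sigma tau a b ->
  exists (g : 'M[R[i]]_n) (h : 'M[R[i]]_m),
    [/\ g \in unitmx, h \in unitmx, tuple_norm (tuple_act g A h) = 1 &
      moment_norm (tuple_act g A h) =
      Num.sqrt (\sum_k diag_gradient rho A sigma tau a b k ^+ 2)].
Proof.
move=> n0 m0 r0 hmin F0; have [hs ht _ _ _] := hmin.1.
set F := exp_weight _ _ _ _ _ _ in F0.
have F0' : 0 < exp_weight rho (adj_tuple A) tau sigma b a by rewrite exp_weight_adj.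
(* F is the squared norm of the tuple before normalisation. *)
pose c := (Num.sqrt F)^-1.
have c0 : c != 0 by rewrite invr_neq0 // sqrtr_eq0 -ltNge.
have c2 : c ^+ 2 = F^-1 by rewrite exprVn sqr_sqrtr // ltW.
pose g := rdiag (fun i => c * half_exp rho a i) *m sigma.
pose h := rdiag (half_exp rho b) *m tau.
exists g, h; set B := tuple_act g A h.
have massB i j : mass B i j =
    mass (tuple_act sigma A tau) i j * expR (rho * (a i + b j)) / F.
  rewrite /B /g /h -tuple_actM mass_rdiag !exprMn c2 !half_exp_sqr mulrDr expRD.
  by ring.
have rowB i : \sum_j mass B i j = row_weight rho A sigma tau a b i / F.
  by under eq_bigr do rewrite massB; rewrite -mulr_suml.
have colB j : \sum_i mass (adj_tuple B) j i = row_weight rho (adj_tuple A) tau sigma b a j / F.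
  under eq_bigr do rewrite mass_adj massB.
  by rewrite -mulr_suml row_weight_adj.
have off1 i k : i != k -> moment B i k = 0.
  by move=> ik; apply: moment_rdiag_offdiag; exact: minimizer_offdiag r0 hmin F0 ik.
have off2 j k : j != k -> moment (adj_tuple B) j k = 0.
  (* The factor c moves to the side of tau, and the row result is applied to the adjoint
     minimiser. *)
  move=> jk; rewrite /B adj_tuple_act /g /h -rdiag_act_scale.
  by apply: moment_rdiag_offdiag; exact: minimizer_offdiag r0 (minimizer_adj hmin) F0' jk.
split.
- rewrite /g unitmx_mul (unitarymx_unit hs) andbT.
  by apply: rdiag_unit => i; rewrite mulf_neq0 // gt_eqF // expR_gt0.
- rewrite /h unitmx_mul (unitarymx_unit ht) andbT.
  by apply: rdiag_unit => i; rewrite gt_eqF // expR_gt0.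
- rewrite tuple_normE; under eq_bigr do rewrite rowB.
  by rewrite -mulr_suml sum_row_weight divff ?sqrtr1 // gt_eqF.
rewrite -[LHS](ger0_norm (moment_norm_ge0 B)) -sqrtr_sqr moment_normE_sum.
congr Num.sqrt; rewrite (shifted_moment_diag off1) (shifted_moment_diag off2).
rewrite big_sum_split; congr (_ + _); apply: eq_bigr => k _; first by rewrite rowB.
by rewrite colB.
Qed.

(** The normalised minimiser is an admissible pair (g, h), so the pairing of (a, b) with the
    gradient is at most - kappa. Thus the left side has nonpositive slope at rho, and [expsum_decay]
    compares it with s = 0, where unitary invariance gives the mass of A. *)
Lemma minimizer_decay (R : realType) (n m N : nat) (rho kappa s : R)
    (A : 'I_N -> 'M[R[i]]_(n, m)) sigma tau (a : 'I_n -> R) (b : 'I_m -> R) :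
  (0 < n)%N -> (0 < m)%N -> 0 < rho -> minimizer rho A sigma tau a b ->
  0 < exp_weight rho A sigma tau a b ->
  (forall g h, g \in unitmx -> h \in unitmx -> tuple_norm (tuple_act g A h) = 1 ->
    kappa <= moment_norm (tuple_act g A h)) ->
  0 <= s <= rho ->
  \sum_i \sum_j mass (tuple_act sigma A tau) i j * expR (s * (a i + b j + kappa)) <=
  \sum_i \sum_j mass A i j.
Proof.
move=> n0 m0 r0 hmin F0 hk hs.
have [g [h [hg hh h1 hK]]] := minimizer_normalized n0 m0 r0 hmin F0.
have kK := hk g h hg hh h1; rewrite hK in kK.
have [+ _] := minimizer_diag_gradient n0 m0 r0 hmin F0.
cbv zeta; have [us ut a0 b0 _] := hmin.1.
rewrite (diag_gradient_pairing _ _ _ _ _ _ a0 b0) => hl.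
move: kK; rewrite -lerN2 => /(le_trans hl); rewrite ler_pdivrMr // => hW.
rewrite -(sum_mass_unitary A us ut) 2!pair_big /=.
apply: (@expsum_decay _ _ (fun k : 'I_n * 'I_m => mass (tuple_act sigma A tau) k.1 k.2)
  (fun k => a k.1 + b k.2 + kappa) rho s) => //; first by move=> k; exact: mass_ge0.
(* The slope at rho is e^(rho kappa) times the sum of the unnormalised pairing and kappa times the
   weight. *)
have -> : \sum_(k : 'I_n * 'I_m) mass (tuple_act sigma A tau) k.1 k.2 *
      expR (rho * (a k.1 + b k.2 + kappa)) * (a k.1 + b k.2 + kappa) =
    expR (rho * kappa) * (\sum_i a i * row_weight rho A sigma tau a b i +
     \sum_j b j * row_weight rho (adj_tuple A) tau sigma b a j
     + kappa * exp_weight rho A sigma tau a b).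
  under [X in _ + X + _]eq_bigr do rewrite row_weight_adj mulr_sumr.
  under [X in X + _ + _]eq_bigr do rewrite mulr_sumr.
  rewrite [X in _ + X + _]exchange_big /exp_weight 3!pair_big /= mulr_sumr -!big_split.
  rewrite mulr_sumr; apply: eq_bigr => k _ /=.
  by rewrite (mulrDr rho (a k.1 + b k.2)) expRD; ring.
by rewrite pmulr_rle0 ?expR_gt0 //; move: hW; rewrite mulNr; lra.
Qed.

(** * Compactness *)

Lemma continuous_sumr (R : realType) (T : topologicalType) (I : Type) (r : seq I)
    (F : I -> T -> R) :
  (forall k, continuous (F k)) -> continuous (fun x => \sum_(k <- r) F k x).
Proof.
move=> cF; elim: r => [|k r ih] x.
  under eq_fun do rewrite big_nil; exact: cvg_cst.
under eq_fun do rewrite big_cons; apply: cvgD; [exact: cF|exact: ih].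
Qed.

Lemma continuous_mul_expR (R : realType) (T : topologicalType) (s c : R)
    (f g h : T -> R) : continuous f -> continuous g -> continuous h ->
  continuous (fun x => f x * expR (s * (g x + h x + c))).
Proof.
move=> cf cg ch x; apply: cvgM; first exact: cf.
apply: continuous_comp; last exact: continuous_expR.
apply: cvgM; first exact: cvg_cst.
by apply: cvgD; [apply: cvgD; [exact: cg|exact: ch]|exact: cvg_cst].
Qed.

(** Continuity is expressed through real and imaginary parts, matching the real coordinates of
    [conf]. *)
Definition ccontinuous (R : realType) (T : topologicalType) (f : T -> R[i]) : Prop :=
  continuous (fun x => complex.Re (f x)) /\ continuous (fun x => complex.Im (f x)).

Lemma ccontinuous_cst (R : realType) (T : topologicalType) (c : R[i]) :
  ccontinuous (fun _ : T => c).
Proof. by split=> x; exact: cvg_cst. Qed.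

Lemma ccontinuousM (R : realType) (T : topologicalType) (f g : T -> R[i]) :
  ccontinuous f -> ccontinuous g -> ccontinuous (fun x => f x * g x).
Proof.
move=> [f1 f2] [g1 g2]; split=> x.
- rewrite (_ : (fun x => _) = fun x => complex.Re (f x) * complex.Re (g x)
      - complex.Im (f x) * complex.Im (g x)); last first.
    by apply/funext => y; case: (f y) (g y) => [? ?] [? ?].
  by apply: cvgB; apply: cvgM; [exact: f1|exact: g1|exact: f2|exact: g2].
rewrite (_ : (fun x => _) = fun x => complex.Re (f x) * complex.Im (g x)
    + complex.Im (f x) * complex.Re (g x)); last first.
  by apply/funext => y; case: (f y) (g y) => [? ?] [? ?].
by apply: cvgD; apply: cvgM; [exact: f1|exact: g2|exact: f2|exact: g1].
Qed.

Lemma ccontinuous_conj (R : realType) (T : topologicalType) (f : T -> R[i]) :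
  ccontinuous f -> ccontinuous (fun x => Num.conj (f x)).
Proof.
move=> [f1 f2]; split=> x.
  rewrite (_ : (fun x => _) = fun x => complex.Re (f x)); first exact: f1.
  by apply/funext => y; rewrite conjCE Re_conjc.
rewrite (_ : (fun x => _) = fun x => - complex.Im (f x)).
  by apply: cvgN; exact: f2.
by apply/funext => y; rewrite conjCE; case: (f y).
Qed.

Lemma ccontinuous_sum (R : realType) (T : topologicalType) (I : finType)
    (F : I -> T -> R[i]) :
  (forall k, ccontinuous (F k)) -> ccontinuous (fun x => \sum_k F k x).
Proof.
move=> cF; split.
  under eq_fun do rewrite Re_sum; apply: continuous_sumr => k; exact: (cF k).1.
rewrite (_ : (fun x => _) = fun x => \sum_k complex.Im (F k x)).
  by apply: continuous_sumr => k; exact: (cF k).2.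
by apply/funext => x; apply: (big_morph (@complex.Im R)) => // -[? ?] [? ?].
Qed.

Definition mxcontinuous (R : realType) (T : topologicalType) (p q : nat)
  (F : T -> 'M[R[i]]_(p, q)) : Prop := forall i j, ccontinuous (fun x => F x i j).

Lemma mxcontinuousM (R : realType) (T : topologicalType) (p q r : nat)
    (F : T -> 'M[R[i]]_(p, q)) (G : T -> 'M[R[i]]_(q, r)) :
  mxcontinuous F -> mxcontinuous G -> mxcontinuous (fun x => F x *m G x).
Proof.
move=> cF cG i j; under eq_fun do rewrite mxE.
by apply: ccontinuous_sum => k; exact: ccontinuousM.
Qed.

Lemma mxcontinuous_adj (R : realType) (T : topologicalType) (p q : nat)
    (F : T -> 'M[R[i]]_(p, q)) :
  mxcontinuous F -> mxcontinuous (fun x => (F x) ^t*).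
Proof.
by move=> cF i j; under eq_fun do rewrite adjmxE; exact: ccontinuous_conj.
Qed.

Lemma mxcontinuous_cst (R : realType) (T : topologicalType) (p q : nat)
    (M : 'M[R[i]]_(p, q)) : mxcontinuous (fun _ : T => M).
Proof. by move=> i j; exact: ccontinuous_cst. Qed.

Lemma continuous_mass (R : realType) (T : topologicalType) (n m N : nat)
    (A : 'I_N -> 'M[R[i]]_(n, m)) (F : T -> 'M[R[i]]_n) (G : T -> 'M[R[i]]_m) i j :
  mxcontinuous F -> mxcontinuous G ->
  continuous (fun x => mass (tuple_act (F x) A (G x)) i j).
Proof.
move=> cF cG; apply: continuous_sumr => l.
have [c1 c2] : ccontinuous (fun x => tuple_act (F x) A (G x) l i j).
  apply: mxcontinuousM; last exact: mxcontinuous_adj.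
  by apply: mxcontinuousM => //; exact: mxcontinuous_cst.
by move=> x; apply: cvgD; apply: cvgM; [exact: c1|exact: c1|exact: c2|exact: c2].
Qed.

Lemma closed_eq_continuous (R : realType) (T : topologicalType) (f : T -> R) (c : R) :
  continuous f -> closed [set x | f x = c].
Proof.
move=> cf; rewrite (_ : [set x | _] = f @^-1` [set c]) //.
by apply: preimage_closed => [x _|]; [exact: cf|exact: closed_eq].
Qed.

Lemma closed_le_continuous (R : realType) (T : topologicalType) (f : T -> R) (c : R) :
  continuous f -> closed [set x | f x <= c].
Proof.
move=> cf; rewrite (_ : [set x | _] = f @^-1` [set y | y <= c]) //.
by apply: preimage_closed => [x _|]; [exact: cf|exact: closed_le].
Qed.

Lemma closed_mx_eq (R : realType) (T : topologicalType) (p q : nat)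
    (F : T -> 'M[R[i]]_(p, q)) (M : 'M[R[i]]_(p, q)) :
  mxcontinuous F -> closed [set x | F x = M].
Proof.
move=> cF; rewrite (_ : [set x | _] = \bigcap_(k in [set: 'I_p * 'I_q])
   ([set x | complex.Re (F x k.1 k.2) = complex.Re (M k.1 k.2)] `&`
    [set x | complex.Im (F x k.1 k.2) = complex.Im (M k.1 k.2)])).
  by apply: closed_bigI => k _; apply: closedI; apply: closed_eq_continuous;
    [exact: (cF _ _).1|exact: (cF _ _).2].
apply/seteqP; split=> x /= h; first by move=> k _ /=; rewrite h.
apply/matrixP => i j.
have [] := h (i, j) I; move=> /=; case: (F x i j) (M i j) => [? ?] [? ?] /=.
by move=> -> ->.
Qed.

(** * The compact set of configurations *)

Section Configurations.
Variables (R : realType) (n m : nat).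

Definition conf_index : eqType :=
  ('I_n * 'I_n + 'I_n * 'I_n + ('I_m * 'I_m + 'I_m * 'I_m) + ('I_n + 'I_m))%type.

(* Real coordinates of (sigma, tau, a, b), so that Tychonoff's theorem applies. *)
Definition conf := prod_topology (fun _ : conf_index => R : topologicalType).

Definition conf_l (x : conf) : 'M[R[i]]_n :=
  \matrix_(i, j) (x (inl (inl (inl (i, j)))) +i* x (inl (inl (inr (i, j)))))%C.
Definition conf_r (x : conf) : 'M[R[i]]_m :=
  \matrix_(i, j) (x (inl (inr (inl (i, j)))) +i* x (inl (inr (inr (i, j)))))%C.
Definition conf_a (x : conf) (i : 'I_n) : R := x (inr (inl i)).
Definition conf_b (x : conf) (j : 'I_m) : R := x (inr (inr j)).

Definition conf_of (sigma : 'M[R[i]]_n) (tau : 'M[R[i]]_m) (a : 'I_n -> R)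
    (b : 'I_m -> R) : conf := fun k =>
  match k with
  | inl (inl (inl (i, j))) => complex.Re (sigma i j)
  | inl (inl (inr (i, j))) => complex.Im (sigma i j)
  | inl (inr (inl (i, j))) => complex.Re (tau i j)
  | inl (inr (inr (i, j))) => complex.Im (tau i j)
  | inr (inl i) => a i
  | inr (inr j) => b j
  end.

Lemma conf_ofK sigma tau a b :
  [/\ conf_l (conf_of sigma tau a b) = sigma, conf_r (conf_of sigma tau a b) = tau,
      conf_a (conf_of sigma tau a b) = a & conf_b (conf_of sigma tau a b) = b].
Proof.
by split=> //; apply/matrixP => i j; rewrite mxE /=; case: (_ i j).
Qed.

Lemma continuous_coord (k : conf_index) : continuous (fun x : conf => x k).
Proof. exact: (@proj_continuous _ (fun _ : conf_index => R : topologicalType) k). Qed.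

Lemma mxcontinuous_conf_l : mxcontinuous conf_l.
Proof.
move=> i j; split.
  rewrite (_ : (fun x => _) = fun x : conf => x (inl (inl (inl (i, j))))).
    exact: continuous_coord.
  by apply/funext => x; rewrite mxE.
rewrite (_ : (fun x => _) = fun x : conf => x (inl (inl (inr (i, j))))).
  exact: continuous_coord.
by apply/funext => x; rewrite mxE.
Qed.

Lemma mxcontinuous_conf_r : mxcontinuous conf_r.
Proof.
move=> i j; split.
  rewrite (_ : (fun x => _) = fun x : conf => x (inl (inr (inl (i, j))))).
    exact: continuous_coord.
  by apply/funext => x; rewrite mxE.
rewrite (_ : (fun x => _) = fun x : conf => x (inl (inr (inr (i, j))))).
  exact: continuous_coord.
by apply/funext => x; rewrite mxE.
Qed.

Definition conf_feasible : set conf :=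
  [set x | feasible (conf_l x) (conf_r x) (conf_a x) (conf_b x)].

Lemma continuous_sqr (T : topologicalType) (f : T -> R) :
  continuous f -> continuous (fun x => f x ^+ 2).
Proof. by move=> cf x; under eq_fun do rewrite expr2; apply: cvgM; exact: cf. Qed.

Lemma closed_conf_feasible : closed conf_feasible.
Proof.
rewrite (_ : conf_feasible =
  [set x | conf_l x *m (conf_l x) ^t* = 1%:M] `&`
  [set x | conf_r x *m (conf_r x) ^t* = 1%:M] `&`
  [set x | \sum_i conf_a x i = 0] `&` [set x | \sum_j conf_b x j = 0] `&`
  [set x | \sum_i conf_a x i ^+ 2 + \sum_j conf_b x j ^+ 2 <= 1]); last first.
  apply/seteqP; split=> x /=.
    by move=> [/unitarymxP h1 /unitarymxP h2 h3 h4 h5].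
  by move=> [[[[h1 h2] h3] h4] h5]; split=> //; apply/unitarymxP.
have ca i : continuous (conf_a^~ i) by exact: continuous_coord.
have cb j : continuous (conf_b^~ j) by exact: continuous_coord.
repeat apply: closedI.
- apply: closed_mx_eq; apply: mxcontinuousM; first exact: mxcontinuous_conf_l.
  exact: mxcontinuous_adj mxcontinuous_conf_l.
- apply: closed_mx_eq; apply: mxcontinuousM; first exact: mxcontinuous_conf_r.
  exact: mxcontinuous_adj mxcontinuous_conf_r.
- exact/closed_eq_continuous/continuous_sumr.
- exact/closed_eq_continuous/continuous_sumr.
have cA : continuous (fun x : conf => \sum_i conf_a x i ^+ 2).
  by apply: continuous_sumr => i; exact: continuous_sqr (ca i).
have cB : continuous (fun x : conf => \sum_j conf_b x j ^+ 2).
  by apply: continuous_sumr => j; exact: continuous_sqr (cb j).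
exact: closed_le_continuous (fun x => cvgD (cA x) (cB x)).
Qed.

Lemma unitary_entry_le1 (p : nat) (U : 'M[R[i]]_p) i j :
  U \is unitarymx -> `|complex.Re (U i j)| <= 1 /\ `|complex.Im (U i j)| <= 1.
Proof.
move=> /unitarymxP /matrixP /(_ i i); rewrite [RHS]mxE eqxx mxE => h.
have : \sum_k sqnormc (U i k) = 1.
  apply: complexI; rewrite rmorph_sum rmorph1 -[RHS]h; apply: eq_bigr => k _.
  by rewrite adjmxE -sqnormcC.
rewrite (bigD1 j) //= => hs.
have : sqnormc (U i j) <= 1.
  by rewrite -hs lerDl sumr_ge0 // => k _; exact: sqnormc_ge0.
rewrite /sqnormc => h1.
by split; rewrite -(ler_pXn2r (n := 2)) ?nnegrE // expr1n real_normK ?num_real //;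
  apply: le_trans h1; rewrite ?lerDl ?lerDr sqr_ge0.
Qed.

(** A closed subset of a cube: rows of unitary matrices are unit vectors and (a, b) lies in the unit
    ball, so every coordinate is in [-1, 1]. *)
Lemma compact_conf_feasible : compact conf_feasible.
Proof.
apply: (@subclosed_compact _ _ [set x : conf | forall k, `[-1, 1]%classic (x k)]).
- exact: closed_conf_feasible.
- apply: (@tychonoff _ (fun _ : conf_index => R : topologicalType)
    (fun=> `[-1, 1]%classic)) => _.
  exact: segment_compact.
move=> x [hl hr _ _ hab] k; rewrite /= in_itv /= -ler_norml.
have sq1 (y z : R) : 0 <= z -> y ^+ 2 + z <= 1 -> `|y| <= 1.
  move=> z0 h; rewrite -(ler_pXn2r (n := 2)) ?nnegrE // expr1n real_normK ?num_real //.
  by apply: le_trans h; rewrite lerDl.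
have S0 (I : finType) (P : pred I) (f : I -> R) : 0 <= \sum_(i | P i) f i ^+ 2.
  by apply: sumr_ge0 => i _; exact: sqr_ge0.
case: k => [[[[i j]|[i j]]|[[i j]|[i j]]]|[i|j]].
- by have [+ _] := unitary_entry_le1 i j hl; rewrite mxE.
- by have [_ +] := unitary_entry_le1 i j hl; rewrite mxE.
- by have [+ _] := unitary_entry_le1 i j hr; rewrite mxE.
- by have [_ +] := unitary_entry_le1 i j hr; rewrite mxE.
- move: hab; rewrite (bigD1 i) //= -addrA; apply: sq1.
  by rewrite addr_ge0 ?S0.
move: hab; rewrite addrC (bigD1 j) //= -addrA; apply: sq1.
by rewrite addr_ge0 ?S0.
Qed.

End Configurations.

(** The shift [kappa] serves both uses: zero for the existence of minimisers, the infimum for the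
    passage to the limit. *)
Lemma continuous_exp_weight (R : realType) (n m N : nat) (A : 'I_N -> 'M[R[i]]_(n, m))
    (s kappa : R) :
  continuous (fun x : conf R n m => \sum_i \sum_j
    mass (tuple_act (conf_l x) A (conf_r x)) i j *
      expR (s * (conf_a x i + conf_b x j + kappa))).
Proof.
have cF i j : continuous (fun x : conf R n m =>
    mass (tuple_act (conf_l x) A (conf_r x)) i j *
      expR (s * (conf_a x i + conf_b x j + kappa))).
  have c1 := continuous_mass (A := A) (i := i) (j := j)
    (@mxcontinuous_conf_l R n m) (@mxcontinuous_conf_r R n m).
  have c2 := @continuous_coord R n m (inr (inl i)).
  have c3 := @continuous_coord R n m (inr (inr j)).
  have c4 := continuous_mul_expR (s := s) (c := kappa) c1 c2 c3.
  exact: c4.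
exact: continuous_sumr (fun i => continuous_sumr (cF i)).
Qed.

(** * Existence of minimisers and passage to the limit *)

Lemma minimizer_exists (R : realType) (n m N : nat) (rho : R)
    (A : 'I_N -> 'M[R[i]]_(n, m)) :
  exists sigma tau a b, minimizer rho A sigma tau a b.
Proof.
have ne : @conf_feasible R n m !=set0.
  exists (conf_of 1%:M 1%:M (fun=> 0) (fun=> 0)).
  rewrite /conf_feasible /=.
  have [-> -> -> ->] := @conf_ofK R n m 1%:M 1%:M (fun=> 0) (fun=> 0).
  split.
  - by apply/unitarymxP; rewrite trmx1 map_mx1 mulmx1.
  - by apply/unitarymxP; rewrite trmx1 map_mx1 mulmx1.
  - by rewrite big1.
  - by rewrite big1.
  - by rewrite !big1 ?addr0 ?ler01 // => k _; rewrite expr0n.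
have cE : continuous (fun x : conf R n m =>
    exp_weight rho A (conf_l x) (conf_r x) (conf_a x) (conf_b x)).
  have := continuous_exp_weight (A := A) (s := rho) (kappa := 0).
  rewrite (_ : (fun x => _) = fun x : conf R n m =>
    exp_weight rho A (conf_l x) (conf_r x) (conf_a x) (conf_b x)) //.
  apply/funext => x; apply: eq_bigr => i _; apply: eq_bigr => j _.
  by rewrite addr0.
have [x] := compact_EVT_min ne (@compact_conf_feasible R n m)
  (continuous_subspaceT cE).
rewrite inE => hx hmin.
exists (conf_l x), (conf_r x), (conf_a x), (conf_b x); split=> // s t a b hf.
have := hmin (conf_of s t a b); rewrite inE /conf_feasible /=.
by have [-> -> -> ->] := conf_ofK s t a b; exact.
Qed.

(** For each fixed s the bound is a closed condition that holds from some index on, so it passes to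
    a cluster point of the sequence. The bound k + 1 is positive even for k = 0. *)
Lemma feasible_limit (R : realType) (n m N : nat) (A : 'I_N -> 'M[R[i]]_(n, m))
    (kappa F : R) :
  let E s sigma tau (a : 'I_n -> R) (b : 'I_m -> R) := \sum_i \sum_j
    mass (tuple_act sigma A tau) i j * expR (s * (a i + b j + kappa)) in
  (forall k : nat, exists sigma tau a b, feasible sigma tau a b /\
     forall s, 0 <= s <= k.+1%:R -> E s sigma tau a b <= F) ->
  exists sigma tau a b, feasible sigma tau a b /\
     forall s, 0 <= s -> E s sigma tau a b <= F.
Proof.
cbv zeta => h.
pose D (s : R) : set (conf R n m) := [set x | \sum_i \sum_j
    mass (tuple_act (conf_l x) A (conf_r x)) i j *
      expR (s * (conf_a x i + conf_b x j + kappa)) <= F].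
have {h} h (k : nat) : exists x : conf R n m, conf_feasible x /\
    forall s, 0 <= s <= k.+1%:R -> D s x.
  have [s [t [a [b [hf hE]]]]] := h k; exists (conf_of s t a b).
  by rewrite /D /conf_feasible /=; have [-> -> -> ->] := conf_ofK s t a b.
have [u hu] := choice h.
have [|x [hx clx]] := @compact_conf_feasible R n m (u @ \oo) _.
  by exists 0%N => // k _; exact: (hu k).1.
exists (conf_l x), (conf_r x), (conf_a x), (conf_b x); split=> // s s0.
have clD : closed (D s).
  exact: closed_le_continuous (continuous_exp_weight (A := A) (s := s) (kappa := kappa)).
apply: clD => V xV; apply: clx xV.
(* The index k = [truncn s] already suffices, since s < [truncn s] + 1. *)
exists (Num.truncn s) => // k /= sk; apply: (hu k).2; rewrite s0 /=.
by rewrite (le_trans (ltW (truncnS_gt s))) // ler_nat ltnS.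
Qed.

(** * The duality theorem *)

Lemma max_weight_leP (R : realType) (n m N : nat) (B : 'I_N -> 'M[R[i]]_(n, m))
    (a : 'cV[R]_n) (b : 'cV[R]_m) (mu : R) :
  (max_weight B a b <= mu%:E)%E <->
  forall l i j, B l i j != 0 -> a i 0 + b j 0 <= mu.
Proof.
split=> [/bigmax_leP[_ h] l i j Bij|h].
  by rewrite -lee_fin; apply: (h (i, j)); apply/existsP; exists l.
apply/bigmax_leP; split=> [|[i j] /existsP[l Bij]]; first exact: leNye.
by rewrite lee_fin (h l).
Qed.

(** Positive total mass makes the joint support nonempty, which excludes the default value -oo of
    the maximum. *)
Lemma max_weight_fin_num (R : realType) (n m N : nat) (B : 'I_N -> 'M[R[i]]_(n, m))
    (a : 'cV[R]_n) (b : 'cV[R]_m) :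
  0 < \sum_i \sum_j mass B i j -> max_weight B a b \is a fin_num.
Proof.
move=> hB; rewrite fin_numE; apply/andP; split; last first.
  rewrite -ltey; apply: (big_ind (fun x => x < +oo)%E) => [|x y hx hy|k _].
  - by [].
  - by rewrite maxEle; case: ifP.
  - exact: ltry.
apply: contraPN hB => /eqP h; rewrite lt0r => /andP[/negP + _]; apply; apply/eqP.
rewrite big1 // => i _; rewrite big1 // => j _; apply: mass_eq0 => l.
apply/eqP; apply: contraPT h => Bij.
suff : (-oo < max_weight B a b)%E by move=> + E; rewrite E ltxx.
apply: lt_le_trans (ltNyr (a i 0 + b j 0)) _.
apply: (le_bigmax_cond _ (fun ij : 'I_n * 'I_m => (a ij.1 0 + b ij.2 0)%:E) (j := (i, j))).
by apply/existsP; exists l.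
Qed.

(** Take z to be a p-th root of 1 / det U; it has modulus 1 because det U has. *)
Lemma unitary_phase (R : realType) (p : nat) (U : 'M[R[i]]_p) :
  (0 < p)%N -> U \is unitarymx ->
  exists2 z : R[i], z != 0 & special_unitary (z *: U).
Proof.
move=> p0 hU; pose z := p.-root ((\det U)^-1).
have zp : z ^+ p = (\det U)^-1 by exact: rootCK.
have U0 : \det U != 0 by rewrite -unitfE -unitmxE unitarymx_unit.
have dU : `|\det U| = 1.
  apply/eqP; rewrite -(pexpr_eq1 (n := 2)) // normCK.
  have <- : \det (U ^t*) = Num.conj (\det U) by rewrite det_map_mx det_tr.
  by rewrite -det_mulmx (unitarymxP hU) det1.
have z1 : `|z| = 1.
  apply/eqP; rewrite -(pexpr_eq1 p0) // -normrX zp normfV dU invr1 //.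
exists z; first by rewrite -normr_gt0 z1.
split; last by rewrite detZ zp mulVf.
apply/unitarymxP; rewrite linearZ map_mxZ -scalemxAl -scalemxAr scalerA.
by rewrite (unitarymxP hU) /= -normCK z1 expr1n scale1r.
Qed.

Lemma tuple_actZ (R : realType) (n m N : nat) (y z : R[i]) (s : 'M[R[i]]_n)
    (A : 'I_N -> 'M[R[i]]_(n, m)) (t : 'M[R[i]]_m) l i j :
  tuple_act (y *: s) A (z *: t) l i j = y * Num.conj z * tuple_act s A t l i j.
Proof.
have -> : tuple_act (y *: s) A (z *: t) l = (y * Num.conj z) *: tuple_act s A t l.
  by rewrite /tuple_act linearZ map_mxZ -!scalemxAl -scalemxAr scalerA mulrC.
by rewrite mxE.
Qed.

Lemma exp_weight_gt0 (R : realType) (n m N : nat) (rho : R)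
    (A : 'I_N -> 'M[R[i]]_(n, m)) sigma tau (a : 'I_n -> R) (b : 'I_m -> R) :
  sigma \is unitarymx -> tau \is unitarymx -> 0 < \sum_i \sum_j mass A i j ->
  0 < exp_weight rho A sigma tau a b.
Proof.
move=> hs ht; rewrite -(sum_mass_unitary A hs ht) /exp_weight !lt0r => /andP[S0 _].
have ge0 i j : 0 <= mass (tuple_act sigma A tau) i j * expR (rho * (a i + b j)).
  by rewrite mulr_ge0 ?mass_ge0 ?expR_ge0.
rewrite !sumr_ge0 ?andbT => [|i _]; last exact: sumr_ge0.
apply: contraNneq S0 => h; apply/eqP; apply: big1 => i _; apply: big1 => j _.
have h1 := psumr_eq0P (fun i _ => sumr_ge0 _ (fun j _ => ge0 i j)) h (i := i) isT.
have /eqP := psumr_eq0P (fun j _ => ge0 i j) h1 (i := j) isT.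
by rewrite mulf_eq0 [expR _ == 0]gt_eqF ?expR_gt0 // orbF => /eqP.
Qed.

(** If v > 0, then s = F / (c v) gives c e^(F / c) >= c + F > F. *)
Lemma bounded_exp_le0 (R : realType) (c v F : R) :
  0 < c -> (forall s, 0 <= s -> c * expR (s * v) <= F) -> v <= 0.
Proof.
move=> c0 h; rewrite leNgt; apply/negP => v0.
have F0 : 0 <= F.
  by apply: le_trans (h 0 (lexx _)); rewrite mulr_ge0 ?expR_ge0 ?ltW.
have s0 : 0 <= F / c / v by rewrite !divr_ge0 // ltW.
have := h _ s0; rewrite divfK ?gt_eqF // -ler_pdivlMl // mulrC leNgt.
by rewrite (lt_le_trans _ (expR_ge1Dx _)) // ltrDr ltr01.
Qed.

(** In the limit configuration the exponential sum stays bounded for all s >= 0. Its terms are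
    nonnegative, so each term on the support is bounded too and its exponent is nonpositive. *)
Lemma strong_duality (R : realType) (n m N : nat) (A : 'I_N -> 'M[R[i]]_(n, m))
    (kappa : R) :
  (0 < n)%N -> (0 < m)%N -> 0 < \sum_i \sum_j mass A i j ->
  (forall g h, g \in unitmx -> h \in unitmx -> tuple_norm (tuple_act g A h) = 1 ->
    kappa <= moment_norm (tuple_act g A h)) ->
  exists sigma tau a b, feasible sigma tau a b /\
    forall l i j, tuple_act sigma A tau l i j != 0 -> a i + b j <= - kappa.
Proof.
move=> n0 m0 A0 hk.
have [|sigma [tau [a [b [hf hE]]]]] :=
  @feasible_limit R n m N A kappa (\sum_i \sum_j mass A i j) _.
  move=> k; have [s [t [a [b hmin]]]] := minimizer_exists k.+1%:R A.
  exists s, t, a, b; split=> [|r hr]; first exact: hmin.1.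
  have [hs ht _ _ _] := hmin.1.
  exact: minimizer_decay n0 m0 (ltr0Sn R k) hmin (exp_weight_gt0 _ a b hs ht A0) hk hr.
exists sigma, tau, a, b; split=> // l i j Bij.
have cpos : 0 < mass (tuple_act sigma A tau) i j.
  rewrite /mass (bigD1 l) //= ltr_pwDl ?sqnormc_gt0 // sumr_ge0 // => q _.
  exact: sqnormc_ge0.
rewrite -subr_le0 opprK; apply: (bounded_exp_le0 cpos) => s s0.
apply: le_trans (hE s s0).
have ge0 i' j' : 0 <= mass (tuple_act sigma A tau) i' j' * expR (s * (a i' + b j' + kappa)).
  by rewrite mulr_ge0 ?mass_ge0 ?expR_ge0.
rewrite (bigD1 i) //= (bigD1 j) //=; apply: ler_wpDr.
  by apply: sumr_ge0 => i' _; exact: sumr_ge0.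
by apply: ler_wpDr; [exact: sumr_ge0|exact: lexx].
Qed.

(** Otherwise A = 0, and the all-ones vector, nonzero as m > 0, would lie in the common kernel. *)
Lemma sum_mass_gt0 (R : realType) (n m N : nat) (A : 'I_N -> 'M[R[i]]_(n, m)) :
  (0 < m)%N ->
  \bigcap_(l in [set: 'I_N]) [set v : 'cV[R[i]]_m | A l *m v = 0] = [set 0] ->
  0 < \sum_i \sum_j mass A i j.
Proof.
move=> m0 kerA; rewrite lt0r !sumr_ge0 ?andbT => [|i _]; last first.
  by apply: sumr_ge0 => j _; exact: mass_ge0.
apply/eqP => h.
have A0 l : A l = 0.
  apply/matrixP => i j; rewrite mxE; apply/eqP; apply: contraT => /sqnormc_gt0 hp.
  have h1 := psumr_eq0P (fun i _ => sumr_ge0 _ (fun j _ => mass_ge0 A i j)) h (i := i) isT.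
  have h2 := psumr_eq0P (fun j _ => mass_ge0 A i j) h1 (i := j) isT.
  have h3 := psumr_eq0P (fun l _ => sqnormc_ge0 (A l i j)) h2 (i := l) isT.
  by rewrite h3 ltxx in hp.
have : [set (0 : 'cV[R[i]]_m)] (const_mx 1).
  by rewrite -kerA => l _ /=; rewrite A0 mul0mx.
move=> /= /matrixP /(_ (Ordinal m0) 0); rewrite !mxE => /eqP.
by rewrite oner_eq0.
Qed.

Unset Implicit Arguments.

Theorem theorem4p20 (R : realType) (n m N : nat)
    (n_gt0 : (0 < n)%N) (m_gt0 : (0 < m)%N) (N_gt0 : (0 < N)%N)
    (A : 'I_N -> 'M[R[i]]_(n, m))
    (kerA : \bigcap_(l in [set: 'I_N]) [set v : 'cV[R[i]]_m | A l *m v = 0]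
            = [set 0])
    (kerAadj : \bigcap_(l in [set: 'I_N])
                 [set w : 'cV[R[i]]_n | (A l) ^t* *m w = 0] = [set 0]) :
  ereal_inf [set x : \bar R | exists (g : 'M[R[i]]_n) (h : 'M[R[i]]_m),
    [/\ g \in unitmx, h \in unitmx, tuple_norm (tuple_act g A h) = 1 &
      x = (mxpair_norm
             (\sum_(l < N) g *m A l *m h ^t* *m h *m (A l) ^t* *m g ^t*
                - (n%:R^-1)%:M)
             (\sum_(l < N) h *m (A l) ^t* *m g ^t* *m g *m A l *m h ^t*
                - (m%:R^-1)%:M))%:E]]
  = ereal_sup [set x : \bar R |
      exists (sigma : 'M[R[i]]_n) (tau : 'M[R[i]]_m)
             (a : 'cV[R]_n) (b : 'cV[R]_m),
    [/\ special_unitary sigma /\ special_unitary tau,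
        vecpair_norm a b <= 1,
        \sum_i a i 0 = 0, \sum_j b j 0 = 0 &
        x = (- max_weight (tuple_act sigma A tau) a b)%E]].
Proof.
have A0 := sum_mass_gt0 m_gt0 kerA.
set S := [set x : \bar R | exists g h, _]; set T := [set x : \bar R | exists sigma tau a b, _].
have SP x : S x <-> exists g h, [/\ g \in unitmx, h \in unitmx,
    tuple_norm (tuple_act g A h) = 1 & x = (moment_norm (tuple_act g A h))%:E].
  by split=> -[g [h [? ? ? ->]]]; exists g, h; rewrite moment_normE.
(* The inequality sup <= inf comes first; there the maximum is finite because the unitary action
   preserves the positive total mass. *)
apply/le_anti/andP; split; last first.
  apply: ge_ereal_sup => _ [s [t [a [b [[[hs _] [ht _]] hab a0 b0 ->]]]]].
  apply/ereal_infP => _ /SP[g [h [_ _ h1 ->]]].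
  have hfin : max_weight (tuple_act s A t) a b \is a fin_num.
    by apply: max_weight_fin_num; rewrite (sum_mass_unitary A hs ht).
  rewrite -(fineK hfin) -EFinN lee_fin.
  apply: (weak_duality h1 hs ht _ _ a0 b0); last by rewrite -vecpair_norm_le1.
  by apply/max_weight_leP; rewrite fineK.
(* To serve as kappa, the infimum must be real: it is at least 0, and a minimiser for rho = 1
   provides an admissible pair. *)
have Sge0 : (0 <= ereal_inf S)%E.
  by apply/ereal_infP => _ /SP[g [h [_ _ _ ->]]]; rewrite lee_fin moment_norm_ge0.
have [x Sx] : S !=set0.
  have [s [t [a [b hmin]]]] := minimizer_exists 1 A.
  have [hs ht _ _ _] := hmin.1.
  have [g [h [hg hh h1 _]]] := minimizer_normalized n_gt0 m_gt0 ltr01 hmin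
    (exp_weight_gt0 1 a b hs ht A0).
  by exists (moment_norm (tuple_act g A h))%:E; apply/SP; exists g, h.
have Sfin : ereal_inf S \is a fin_num.
  rewrite ge0_fin_numE //; apply: le_lt_trans (ereal_inf_lbound Sx) _.
  by have /SP[g [h [_ _ _ ->]]] := Sx; exact: ltry.
have [|s [t [a [b [[hs ht a0 b0 hab] hw]]]]] :=
  @strong_duality R n m N A (fine (ereal_inf S)) n_gt0 m_gt0 A0 _.
  move=> g h hg hh h1; rewrite -lee_fin fineK //; apply: ereal_inf_lbound.
  by apply/SP; exists g, h.
(* Multiplication by phases reaches determinant 1 without changing the joint support. *)
have [y y0 hy] := unitary_phase n_gt0 hs.
have [z z0 hz] := unitary_phase m_gt0 ht.
apply: (@le_trans _ _ (- max_weight (tuple_act (y *: s) A (z *: t))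
    (\col_i a i) (\col_j b j))%E); last first.
  apply: ereal_sup_ubound; exists (y *: s), (z *: t), (\col_i a i), (\col_j b j).
  split=> //.
  - rewrite vecpair_norm_le1.
    by under eq_bigr do rewrite mxE; under [X in _ + X]eq_bigr do rewrite mxE.
  - by under eq_bigr do rewrite mxE.
  - by under eq_bigr do rewrite mxE.
rewrite leeNr -(fineK Sfin) -EFinN.
apply/max_weight_leP => l i j; rewrite tuple_actZ mulf_eq0 negb_or.
by move=> /andP[_ /hw]; rewrite !mxE.
Qed.
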